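(* Let $\theta_{n+1}=\theta_n-\alpha_n(\nabla f(\theta_n)+w_n)$, $n\ge 0$, be the stochastic gradient recursion described in the context, and let $\Lambda=\{\sup_{n\ge 0}\|\theta_n\|<\infty\}$. Suppose that: (i) $\lim_{n\to\infty}\alpha_n=0$ and $\sum_{n=0}^\infty\alpha_n=\infty$; (ii) there exists a real number $r\in(0,\infty)$ such that $w=\limsup_{n\to\infty}\max_{n\le k<a(n,1)}\left\|\sum_{i=n}^k\alpha_i\gamma_i^r w_i\right\|<\infty$ w.p.1 on $\Lambda$; (iii) for any compact set $Q\subset\mathbb{R}^{d_\theta}$ and any $a\in f(Q)$, there exist real numbers $\delta_{Q,a}\in(0,1)$, $\mu_{Q,a}\in(1,2]$, $M_{Q,a}\in[1,\infty)$ such that $|f(\theta)-a|\le M_{Q,a}\|\nabla f(\theta)\|^{\mu_{Q,a}}$ for all $\theta\in Q$ satisfying $|f(\theta)-a|\le\delta_{Q,a}$. Then there exists a random quantity $\hat K$ (which is a deterministic function of $\hat C,\hat M$) such that $1\le\hat K<\infty$ everywhere and such that $$\limsup_{n\to\infty}\gamma_n^{\hat p}\|\nabla f(\theta_n)\|^2\le\hat K(\phi(w))^{\hat\mu},\qquad \limsup_{n\to\infty}\gamma_n^{\hat p}|f(\theta_n)-\hat f|\le\hat K(\phi(w))^{\hat\mu}$$ w.p.1 on $\Lambda$. If additionally (iv) for any compact set $Q\subset\mathbb{R}^{d_\theta}$ there exist real numbers $\nu_Q\in(0,1]$, $N_Q\in[1,\infty)$ such that $d(\theta,S)\le N_Q\|\nabla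 f(\theta)\|^{\nu_Q}$ for all $\theta\in Q$, then there exists another random quantity $\hat L$ (which is a deterministic function of $\hat C,\hat M,\hat N$) such that $1\le\hat L<\infty$ everywhere and such that $$\limsup_{n\to\infty}\gamma_n^{\hat q}\,d(\theta_n,S)\le\hat L(\phi(w))^{\hat\nu}$$ w.p.1 on $\Lambda$.
   Context: $f:\mathbb{R}^{d_\theta}\to\mathbb{R}$ is a differentiable function whose gradient $\nabla f$ is locally Lipschitz continuous. $\{\alpha_n\}_{n\ge 0}$ is a sequence of positive real numbers. On a probability space $(\Omega,\mathcal{F},P)$, $\theta_0$ is an $\mathbb{R}^{d_\theta}$-valued random variable and $\{w_n\}_{n\ge 0}$ is an $\mathbb{R}^{d_\theta}$-valued stochastic process (for each $n$, $w_n$ may be a random function of $\theta_0,\dots,\theta_n$). $\|\cdot\|$ is the Euclidean norm and $d(\cdot,\cdot)$ the induced distance. $S=\{\theta\in\mathbb{R}^{d_\theta}:\nabla f(\theta)=0\}$. $\gamma_0=0$ and $\gamma_n=\sum_{i=0}^{n-1}\alpha_i$ for $n\ge 1$. For $t\in(0,\infty)$, $n\ge 0$, $a(n,t)=\max\{k\ge n:\gamma_k-\gamma_n\le t\}$. ''W.p.1 on an event $A$'' means for all $\omega\in A$ outside a set of probability zero. For compact $Q\subset\mathbb{R}^{d_\theta}$, $C_Q\in[1,\infty)$ is an upper bound of $\|\nabla f\|$ on $Q$ and a Lipschitz constant of $\nabla f$ on $Q$. $\hat A$ is the (random) set of accumulation points of $\{\theta_n\}_{n\ge0}$, $\hat f=\liminf_{n\to\infty}f(\theta_n)$,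 and $\hat Q=\{\theta:d(\theta,\hat A)\le\rho\}$ on $\Lambda$, $\hat Q=\hat A$ otherwise, where $\rho$ is an arbitrary positive (deterministic or random) quantity. With a fixed choice of the constants in (iii) (and (iv) when assumed), on $\Lambda$ set $$\hat\delta=\delta_{\hat Q,\hat f},\quad \hat\mu=\mu_{\hat Q,\hat f},\quad \hat\nu=\mu_{\hat Q,\hat f}\,\nu_{\hat Q}/2,\quad \hat C=C_{\hat Q},\quad \hat M=M_{\hat Q,\hat f},\quad \hat N=N_{\hat Q},$$ and off $\Lambda$ set $\hat\delta=1$, $\hat\mu=2$, $\hat\nu=\hat C=\hat M=\hat N=1$. Further, $\hat r=1/(2-\hat\mu)$ if $\hat\mu<2$ and $\hat r=\infty$ if $\hat\mu=2$; $\hat p=\hat\mu\min\{r,\hat r\}$; $\hat q=\hat\nu\min\{r,\hat r\}$. The function $\phi$ is: $\phi(w)=w$ if $r<\hat r$; $\phi(w)=1+w$ if $r=\hat r$; $\phi(w)=1$ if $r>\hat r$. The number $r$ is a fixed constant, so ''deterministic function of $\hat C,\hat M$'' (resp. $\hat C,\hat M,\hat N$) allows dependence on $r$. *)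

(* Defs.v *)
From HB Require Import structures.
From mathcomp Require Import all_boot all_order all_algebra.
From mathcomp Require Import all_classical all_reals all_analysis.

Set Implicit Arguments.
Unset Strict Implicit.
Unset Printing Implicit Defensive.

Import Order.TTheory GRing.Theory Num.Theory.
Import numFieldNormedType.Exports.

Local Open Scope classical_set_scope.
Local Open Scope ring_scope.

Section Euclidean.
Context {R : realType} {d : nat}.
Implicit Types (x y : 'rV[R]_d) (A Q : set 'rV[R]_d).

(* The library norm on 'rV[R]_d is the sup norm, hence a separate Euclidean
   norm; both induce the same topology, so that [compact], [differentiable],
   [cluster] and [open] below are the library notions. *)
Definition enorm x : R := Num.sqrt (\sum_(i < d) x 0 i ^+ 2).

(* Extended-real valued, so that the distance to the empty set is +oo. *)
Definition edist_set x A : \bar R :=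
  ereal_inf [set (enorm (x - y))%:E | y in A].

Definition grad (f : 'rV[R]_d -> R) x : 'rV[R]_d :=
  \row_(i < d) 'D_(delta_mx 0 i) f x.

Definition lipschitz_const_on (g : 'rV[R]_d -> 'rV[R]_d) Q (c : R) : Prop :=
  forall x y, Q x -> Q y -> enorm (g x - g y) <= c * enorm (x - y).

Definition locally_lipschitz (g : 'rV[R]_d -> 'rV[R]_d) : Prop :=
  forall x, exists2 U, nbhs x U & exists c : R, lipschitz_const_on g U c.

Definition stationary_set (f : 'rV[R]_d -> R) : set 'rV[R]_d :=
  [set x | grad f x = 0].

Definition gradient_constants (f : 'rV[R]_d -> R)
    (C : set 'rV[R]_d -> R) : Prop :=
  forall Q, compact Q ->
    [/\ 1 <= C Q,
        forall x, Q x -> enorm (grad f x) <= C Q &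
        lipschitz_const_on (grad f) Q (C Q)].

Definition lojasiewicz_constants (f : 'rV[R]_d -> R)
    (delta mu M : set 'rV[R]_d -> R -> R) : Prop :=
  forall Q (a : R), compact Q -> (f @` Q) a ->
    [/\ 0 < delta Q a < 1, 1 < mu Q a <= 2, 1 <= M Q a &
        forall x, Q x -> `|f x - a| <= delta Q a ->
          `|f x - a| <= M Q a * enorm (grad f x) `^ mu Q a].

Definition error_bound_constants (f : 'rV[R]_d -> R)
    (nu N : set 'rV[R]_d -> R) : Prop :=
  forall Q, compact Q ->
    [/\ 0 < nu Q <= 1, 1 <= N Q &
        forall x, Q x ->
          (edist_set x (stationary_set f)
             <= (N Q * enorm (grad f x) `^ nu Q)%:E)%E].

End Euclidean.

Section StepSizes.
Context {R : realType}.
Variable alpha : nat -> R.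

Definition gamma (n : nat) : R := \sum_(0 <= i < n) alpha i.

(* 0 when [A] has no maximum; this never happens in [window_end] below when
   the step sizes are positive and sum up to +oo, and t > 0. *)
Definition nat_max (A : set nat) : nat :=
  xget 0%N [set k | A k /\ forall j, A j -> (j <= k)%N].

Definition window_end (n : nat) (t : R) : nat :=
  nat_max [set k | (n <= k)%N /\ gamma k - gamma n <= t].

(* The maximum over an empty window is 0; since alpha tends to 0 this concerns
   finitely many n only and does not affect the limit superior. *)
Definition noise_limsup {d : nat} (r : R) (w : nat -> 'rV[R]_d) : \bar R :=
  limn_esup (fun n =>
    (\big[Num.max/0]_(n <= k < window_end n 1)
       enorm (\sum_(n <= i < k.+1) (alpha i * gamma i `^ r) *: w i))%:E).

End StepSizes.

(* The Borel sigma-algebra of 'rV[R]_d is generated by the open sets. *)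
Definition random_vector {R : realType} {d : nat} {disp : measure_display}
    {T : measurableType disp} (X : T -> 'rV[R]_d) : Prop :=
  measurable_fun setT (X : T -> g_sigma_algebraType (@open 'rV[R]_d)).

Section RandomQuantities.
Context {R : realType} {d : nat} {T : Type}.
Variables (f : 'rV[R]_d -> R) (theta : nat -> T -> 'rV[R]_d) (rho : T -> R).

Definition Lambda : set T :=
  [set omega | (ereal_sup (range (fun n => (enorm (theta n omega))%:E))
                  < +oo)%E].

Definition Ahat (omega : T) : set 'rV[R]_d :=
  cluster ((fun n => theta n omega) @ \oo).

(* Only used on [Lambda], where the limit inferior is finite. *)
Definition fhat (omega : T) : R :=
  fine (limn_einf (fun n => (f (theta n omega))%:E)).

Definition Qhat (omega : T) : set 'rV[R]_d :=
  if omega \in Lambda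
  then [set x | (edist_set x (Ahat omega) <= (rho omega)%:E)%E]
  else Ahat omega.

Definition Chat (C : set 'rV[R]_d -> R) (omega : T) : R :=
  if omega \in Lambda then C (Qhat omega) else 1.

Definition muhat (mu : set 'rV[R]_d -> R -> R) (omega : T) : R :=
  if omega \in Lambda then mu (Qhat omega) (fhat omega) else 2.

Definition Mhat (M : set 'rV[R]_d -> R -> R) (omega : T) : R :=
  if omega \in Lambda then M (Qhat omega) (fhat omega) else 1.

Definition nuhat (mu : set 'rV[R]_d -> R -> R) (nu : set 'rV[R]_d -> R)
    (omega : T) : R :=
  if omega \in Lambda
  then mu (Qhat omega) (fhat omega) * nu (Qhat omega) / 2 else 1.

Definition Nhat (N : set 'rV[R]_d -> R) (omega : T) : R :=
  if omega \in Lambda then N (Qhat omega) else 1.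

End RandomQuantities.

Section Rates.
Context {R : realType}.
Variables (r mu : R).

Definition rhat : \bar R := if mu < 2 then ((2 - mu)^-1)%:E else +oo%E.

Definition rate : R := fine (Order.min r%:E rhat).

Definition phi (x : R) : R :=
  if (r%:E < rhat)%E then x else if r%:E == rhat then 1 + x else 1.

End Rates.

(* Main.v *)
Require Import Defs.
From HB Require Import structures.
From mathcomp Require Import all_boot all_order all_algebra.
From mathcomp Require Import all_classical all_reals all_analysis.
From mathcomp Require Import ring lra.

Set Implicit Arguments.
Unset Strict Implicit.
Unset Printing Implicit Defensive.

Import Order.TTheory GRing.Theory Num.Theory.
Import numFieldNormedType.Exports.

Local Open Scope classical_set_scope.
Local Open Scope ring_scope.

(** The statement holds trajectory by trajectory, on every bounded trajectory
    whose noise level is finite.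

    Cut the time scale [gamma] into windows of length of order [1 / C]. Summing
    by parts, the noise accumulated over a window starting at [n] is at most
    [eta n = om * gamma n `^ (- r)], for any [om] above the limit superior [w].
    A first order expansion along the window then shows that [f] changes by at
    most [- g ^+ 2 / (64 * C) + 64 * C * eta n ^+ 2], where [g] is the norm of
    the gradient at [theta n] ([window_decrease], [late_decrease]).

    Convergence. By the Lojasiewicz inequality, a value of [f] slightly above
    its limit inferior keeps the gradient away from zero, so that [f] decreases
    over the window once the noise is small; therefore [f] converges to its
    limit inferior ([value_near_le]) and the gradient to zero. Windows then
    become short chords close to the set of accumulation points, and the
    constants of its neighbourhood apply ([chord_lipschitz_neighborhood]).

    Rate. Put [u n = f (theta n) - fhat] and [q = 2 / mu]. The Lojasiewicz
    inequality turns the window estimate into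
    [u k <= u n - kappa * `|u n| `^ q + 64 * C * eta n ^+ 2], a discrete form of
    [u' = - kappa * u `^ q + noise]. It is compared with a barrier
    [x t = A * t `^ (- p)], where [p = mu * min (r, 1 / (2 - mu))] balances the
    noise and the decay of the noise-free equation. Replacing the power by a
    secant through the barrier gives a linear recursion, for which a multiple of
    [x] plus a faster decaying transient is a supersolution ([upper_rate]).
    Below [- x] the decrease would go on forever, in contradiction with the
    convergence ([lower_rate]). That [A] can be taken of the form
    [factor (C, M) * phi om `^ mu], with a factor free of [mu], is checked in
    [barrier_eventually]. The window estimate read backwards bounds the squared
    gradient by the oscillation of [f], which gives it the same rate
    ([trajectory_rate]); the error bound converts it into a rate for the
    distance to the stationary set. Finally [om] tends to [w]
    ([le_noise_level]). *)

(** * Euclidean norm and descent along a segment *)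

Section EuclideanGeometry.
Context {R : realType} {d : nat}.
Implicit Types (x y : 'rV[R]_d) (A : set 'rV[R]_d) (f : 'rV[R]_d -> R).

Definition dot x y : R := \sum_(i < d) x 0 i * y 0 i.

Lemma enorm_ge0 x : 0 <= enorm x.
Proof. exact: sqrtr_ge0. Qed.

Lemma enorm_sqr x : enorm x ^+ 2 = \sum_(i < d) x 0 i ^+ 2.
Proof. by rewrite sqr_sqrtr // sumr_ge0 // => i _; exact: sqr_ge0. Qed.

Lemma dotxx x : dot x x = enorm x ^+ 2.
Proof. by rewrite enorm_sqr; apply: eq_bigr => i _; rewrite expr2. Qed.

Lemma dotDr x y z : dot x (y + z) = dot x y + dot x z.
Proof. by rewrite -big_split; apply: eq_bigr => i _; rewrite mxE mulrDr. Qed.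

Lemma dotDl x y z : dot (x + y) z = dot x z + dot y z.
Proof. by rewrite -big_split; apply: eq_bigr => i _; rewrite mxE mulrDl. Qed.

Lemma dotZr a x y : dot x (a *: y) = a * dot x y.
Proof. by rewrite mulr_sumr; apply: eq_bigr => i _; rewrite mxE; ring. Qed.

Lemma enormZ a x : enorm (a *: x) = `|a| * enorm x.
Proof.
rewrite /enorm -sqrtr_sqr -sqrtrM ?sqr_ge0 // mulr_sumr.
by congr Num.sqrt; apply: eq_bigr => i _; rewrite mxE exprMn.
Qed.

Lemma enorm0 : enorm (0 : 'rV[R]_d) = 0.
Proof. by rewrite -[0 in LHS](scale0r 0) enormZ normr0 mul0r. Qed.

Lemma enormN x : enorm (- x) = enorm x.
Proof. by rewrite -scaleN1r enormZ normrN1 mul1r. Qed.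

Lemma enormBC x y : enorm (x - y) = enorm (y - x).
Proof. by rewrite -opprB enormN. Qed.

Lemma coord_le_enorm x i : `|x 0 i| <= enorm x.
Proof.
rewrite -sqrtr_sqr ler_sqrt; last by apply: sumr_ge0 => j _; exact: sqr_ge0.
by rewrite (bigD1 i) //= lerDl sumr_ge0 // => j _; exact: sqr_ge0.
Qed.

Lemma enorm_eq0 x : enorm x = 0 -> x = 0.
Proof.
move=> x0; apply/rowP => i; rewrite mxE; apply/eqP.
by rewrite -normr_le0 -x0 coord_le_enorm.
Qed.

Lemma dot_le_enorm x y : dot x y <= enorm x * enorm y.
Proof.
have [x0|xn0] := eqVneq (enorm x) 0.
  rewrite x0 mul0r (enorm_eq0 x0) /dot big1 // => i _.
  by rewrite mxE mul0r.
have [y0|yn0] := eqVneq (enorm y) 0.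
  rewrite y0 mulr0 (enorm_eq0 y0) /dot big1 // => i _.
  by rewrite mxE mulr0.
have xy0 : 0 < enorm x * enorm y.
  by rewrite mulr_gt0 // lt0r ?xn0 ?yn0 enorm_ge0.
(* Both vectors rescaled to the same length: the square of their distance. *)
have : 0 <= dot (enorm y *: x - enorm x *: y) (enorm y *: x - enorm x *: y).
  by rewrite dotxx sqr_ge0.
have -> : dot (enorm y *: x - enorm x *: y) (enorm y *: x - enorm x *: y)
    = enorm y ^+ 2 * dot x x + enorm x ^+ 2 * dot y y
      - 2 * (enorm x * enorm y) * dot x y.
  rewrite /dot !mulr_sumr -big_split -sumrB; apply: eq_bigr => i _ /=.
  by rewrite !mxE; ring.
rewrite !dotxx => h; rewrite -(ler_pM2l xy0); nra.
Qed.

Lemma enormD x y : enorm (x + y) <= enorm x + enorm y.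
Proof.
rewrite -ler_sqr ?nnegrE ?addr_ge0 ?enorm_ge0 // -dotxx dotDl !dotDr !dotxx.
have := dot_le_enorm x y; have := dot_le_enorm y x; nra.
Qed.

Lemma enormB x y : enorm (x - y) <= enorm x + enorm y.
Proof. by rewrite -(enormN y) enormD. Qed.

Lemma enorm_tri z x y : enorm (x - y) <= enorm (x - z) + enorm (z - y).
Proof. by rewrite -[x - y](subrKA z) enormD. Qed.

Lemma enorm_sum (I : Type) (s : seq I) (F : I -> 'rV[R]_d) :
  enorm (\sum_(i <- s) F i) <= \sum_(i <- s) enorm (F i).
Proof.
elim/big_ind2: _ => [|a b c e ab ce|//]; first by rewrite enorm0.
by rewrite (le_trans (enormD _ _)) // lerD.
Qed.

Lemma coord_le_mxnorm x i : `|x 0 i| <= `|x|.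
Proof.
rewrite [leRHS]/Num.norm /= mx_normrE.
by apply: (le_trans _ (le_bigmax _ _ (0, i))).
Qed.

Lemma mxnorm_le_enorm x : `|x| <= enorm x.
Proof.
rewrite [leLHS]/Num.norm /= mx_normrE; apply/bigmax_leP.
split=> [|[i j] _ /=]; first exact: enorm_ge0.
by rewrite ord1 coord_le_enorm.
Qed.

Lemma enorm_le_mxnorm x : enorm x <= d%:R * `|x|.
Proof.
rewrite -ler_sqr ?nnegrE ?mulr_ge0 ?enorm_ge0 // enorm_sqr.
have -> : (d%:R * `|x|) ^+ 2 = \sum_(i < d) (d%:R * `|x| ^+ 2).
  by rewrite sumr_const card_ord -mulr_natl; ring.
apply: ler_sum => i _; rewrite -real_normK ?num_real //.
have d1 : (1 : R) <= d%:R by rewrite ler1n (leq_ltn_trans _ (ltn_ord i)).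
apply: (@le_trans _ _ (`|x| ^+ 2)).
  by rewrite ler_sqr ?nnegrE // coord_le_mxnorm.
by rewrite ler_peMl // sqr_ge0.
Qed.

Lemma enorm_lt_near x (e : R) : 0 < e -> \forall y \near x, enorm (y - x) < e.
Proof.
move=> e0; have D0 : 0 < (d%:R + 1 : R) by rewrite ltr_wpDl.
have : \forall y \near x, `|x - y| < e / (d%:R + 1).
  by apply/nbhs_ballP; exists (e / (d%:R + 1)) => [|y] //=;
    [rewrite divr_gt0|rewrite -ball_normE].
apply: filterS => y; rewrite ltr_pdivlMr // => xy.
rewrite enormBC (le_lt_trans (enorm_le_mxnorm _)) //.
by apply: (le_lt_trans _ xy); have := normr_ge0 (x - y); nra.
Qed.

Lemma derive_dot_grad f x v : differentiable f x -> 'D_v f x = dot (grad f x) v.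
Proof.
move=> df; rewrite deriveE // {1}(row_sum_delta v) linear_sum.
apply: eq_bigr => i _; rewrite linearZ /= mxE deriveE //.
by rewrite /GRing.scale /= mulrC.
Qed.

Lemma segment_mvt f x v : (forall z, differentiable f z) ->
  exists2 t, 0 <= t <= 1 & f (x + v) - f x = dot (grad f (x + t *: v)) v.
Proof.
move=> df; pose h (t : R) := f (x + t *: v).
(* [h] at [t] and [f] at [x + t *: v] have the same difference quotients. *)
have quotE t : (fun s : R => s^-1 *: (h (s *: 1 + t) - h t)) =
    (fun s => s^-1 *: (f (s *: v + (x + t *: v)) - f (x + t *: v))).
  apply/funext => s; rewrite /h; congr (_ *: (f _ - _)).
  by rewrite [s *: 1](mulr1 s) scalerDl addrCA.
have dh (t : R) : is_derive t (1 : R) h (dot (grad f (x + t *: v)) v).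
  have dfx : derivable f (x + t *: v) v by apply: diff_derivable.
  split; first by rewrite /derivable quotE.
  by rewrite -derive_dot_grad // /derive quotE.
have [|t t01 ht] := @MVT_segment _ h (fun t => dot (grad f (x + t *: v)) v) 0 1 ler01.
  apply: continuous_subspaceT => t.
  by apply: differentiable_continuous; apply/derivable1_diffP; case: (dh t).
exists t; first by move: t01; rewrite in_itv.
by move: ht; rewrite /h scale1r scale0r addr0 subr0 mulr1.
Qed.

(** The mean value theorem at an intermediate point of the segment replaces the
    integral remainder; this only costs a factor two in front of [c]. *)
Lemma descent_bound f (c : R) x v : (forall z, differentiable f z) ->
  (forall t, 0 <= t <= 1 ->
     enorm (grad f (x + t *: v) - grad f x) <= c * (t * enorm v)) -> 0 <= c ->
  f (x + v) - f x <= dot (grad f x) v + c * enorm v ^+ 2.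
Proof.
move=> df Lc c0; have [t t01 ->] := segment_mvt x v df.
rewrite -[grad f (x + _)](subrK (grad f x)) dotDl addrC lerD2l.
apply: (le_trans (dot_le_enorm _ _)).
apply: (@le_trans _ _ (c * (t * enorm v) * enorm v)).
  by rewrite ler_wpM2r ?enorm_ge0 // Lc.
have : t * enorm v <= 1 * enorm v by rewrite ler_wpM2r ?enorm_ge0; case/andP: t01.
have := enorm_ge0 v => v0 tv.
have -> : c * (t * enorm v) * enorm v = c * ((t * enorm v) * enorm v) by ring.
by rewrite ler_wpM2l // expr2 ler_wpM2r // -[leRHS]mul1r.
Qed.

End EuclideanGeometry.

(** * Time windows and averaged noise *)

Section Windows.
Context {R : realType}.
Variable alpha : nat -> R.
Hypothesis alpha_gt0 : forall n, 0 < alpha n.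
Hypothesis alpha_cvg0 : alpha @ \oo --> 0.
Hypothesis alpha_sum : (\sum_(0 <= n <oo) (alpha n)%:E = +oo)%E.
Local Notation gamma := (gamma alpha).

Lemma gammaS n : gamma n.+1 = gamma n + alpha n.
Proof. by rewrite /Defs.gamma big_nat_recr. Qed.

Lemma le_gamma m n : (m <= n)%N -> gamma m <= gamma n.
Proof.
move=> mn; rewrite /Defs.gamma (big_cat_nat_idem _ _ mn) //= ?addr0 // lerDl.
by apply: sumr_ge0 => i _; exact: ltW.
Qed.

Lemma gammaB m n : (m <= n)%N -> gamma n - gamma m = \sum_(m <= i < n) alpha i.
Proof.
move=> mn; rewrite /Defs.gamma (big_cat_nat_idem _ _ mn) //= ?addr0 //.
by rewrite addrAC subrr add0r.
Qed.

Lemma gamma_near_ge (A : R) : \forall n \near \oo, A <= gamma n.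
Proof.
have gy : (fun n => (gamma n)%:E) @ \oo --> +oo%E.
  rewrite -alpha_sum; have := @is_cvg_nneseries R (EFin \o alpha) xpredT 0%N.
  move=> /(_ (fun n _ _ => ltW (alpha_gt0 n))) /=.
  by under eq_fun do rewrite sumEFin.
have /cvgeryP/cvgryPge := gy; exact.
Qed.

Lemma gamma_near_gt (A : R) : \forall n \near \oo, A < gamma n.
Proof.
by apply: filterS (gamma_near_ge (A + 1)) => n; apply: lt_le_trans; rewrite ltrDl.
Qed.

Lemma alpha_near_le (e : R) : 0 < e ->
  \forall N \near \oo, forall n, (N <= n)%N -> alpha n <= e.
Proof.
move=> e0; have /cvgrPdist_le/(_ e e0)[N _ HN] := alpha_cvg0.
exists N => // n Nn m nm; have /= := HN m (leq_trans Nn nm).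
by rewrite sub0r normrN; apply: le_trans; exact: ler_norm.
Qed.

(** Since the steps tend to zero, the first index at time distance [s] overshoots
    by at most [s]. *)
Lemma window_after (s : R) : 0 < s -> \forall N \near \oo,
  forall n, (N <= n)%N ->
  exists2 k, (n <= k)%N & s <= gamma k - gamma n <= 2 * s.
Proof.
move=> s0; apply: filterS (alpha_near_le s0) => N HN n Nn.
have [K _ HK] := gamma_near_ge (gamma n + s).
have ex : exists k, (n <= k)%N && (gamma n + s <= gamma k).
  by exists (maxn n K); rewrite leq_maxl HK //= leq_maxr.
case: (ex_minnP ex) => k /andP[nk sk] kmin; exists k => //.
rewrite lerBrDl sk /=; case: k => [|k] in nk sk kmin *.
  by move: nk sk; rewrite leqn0 => /eqP ->; lra.
have [nkk|nkk] := leqP n k; last first.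
  have -> : n = k.+1 by apply/eqP; rewrite eqn_leq nk nkk.
  lra.
have : ~~ (gamma n + s <= gamma k).
  by apply/negP => h; have := kmin k; rewrite nkk h ltnn => /(_ isT).
rewrite -ltNge gammaS => h.
have := HN k (leq_trans Nn nkk); lra.
Qed.

(** The last index at time distance at least [s] in the past, for the same reason,
    is at time distance at most [2 * s]. *)
Lemma window_before (s : R) : 0 < s -> \forall N \near \oo,
  forall n, (N <= n)%N -> s <= gamma n - gamma N ->
  exists2 m, (N <= m < n)%N & s <= gamma n - gamma m <= 2 * s.
Proof.
move=> s0; apply: filterS (alpha_near_le s0) => N HN n Nn sn.
have ex : exists m, (N <= m <= n)%N && (s <= gamma n - gamma m).
  by exists N; rewrite leqnn Nn.
have bnd m : (N <= m <= n)%N && (s <= gamma n - gamma m) -> (m <= n)%N.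
  by case/andP => /andP[].
case: (ex_maxnP ex bnd) => m /andP[/andP[Nm mn] sm] mmax.
have mn' : (m < n)%N.
  by rewrite ltn_neqAle mn andbT; apply/eqP => E; move: sm; rewrite E subrr; lra.
exists m; first by rewrite Nm.
rewrite sm /=; have : ~~ (s <= gamma n - gamma m.+1).
  apply/negP => h; have := mmax m.+1.
  by rewrite mn' h (leq_trans Nm) // ltnn => /(_ isT).
rewrite -ltNge gammaS; have := HN m Nm; lra.
Qed.

(** Strong induction on the index, stepping back to a predecessor one time
    window earlier. Unlike a forward chain of windows, it reaches every index,
    so that no separate estimate is needed between the anchors of a chain. *)
Lemma window_ind (s : R) : 0 < s -> \forall N \near \oo, forall P : nat -> Prop,
  (forall n, (N <= n)%N -> gamma n - gamma N < s -> P n) ->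
  (forall m n, (N <= m < n)%N -> s <= gamma n - gamma m <= 2 * s ->
     P m -> P n) ->
  forall n, (N <= n)%N -> P n.
Proof.
move=> s0; apply: filterS (window_before s0) => N HN P base step.
elim/ltn_ind => n IH Nn; have [sn|] := leP s (gamma n - gamma N); last exact: base.
have [m /andP[Nm mn] smn] := HN n Nn sn.
by apply: (step m) => //; [rewrite Nm|exact: IH].
Qed.

Lemma ltn_window_end n k : (n <= k)%N -> gamma k.+1 - gamma n <= 1 ->
  (k < window_end alpha n 1)%N.
Proof.
move=> nk k1; rewrite /window_end /nat_max.
set A := [set j | _]; have [K _ HK] := gamma_near_gt (gamma n + 1).
have bnd j : (n <= j)%N && (gamma j - gamma n <= 1) -> (j <= K)%N.
  case/andP=> nj; rewrite lerBlDl; apply: contraTT; rewrite -ltNge -ltnNge.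
  by move=> /ltnW; exact: HK.
have ex : exists j, (n <= j)%N && (gamma j - gamma n <= 1).
  by exists n; rewrite leqnn subrr ler01.
have : A !=set0.
  case: (ex_maxnP ex bnd) => j /andP[nj j1] jmax; exists j.
  by split=> [|i [ni i1]]; [split|apply: jmax; rewrite ni].
case/(xgetPex 0%N) => _; apply; split => //=; exact: leqW.
Qed.

End Windows.

Section Noise.
Context {R : realType} {d : nat}.

(** Summation by parts: weights decreasing to a nonnegative value do not
    amplify the bound on the partial sums. *)
Lemma enorm_sum_weighted_le (v : nat -> 'rV[R]_d) (b : nat -> R) n k (B : R) :
  (forall i, (n <= i <= k)%N -> 0 <= b i) ->
  (forall i, (n <= i < k)%N -> b i.+1 <= b i) ->
  (forall j, (n <= j <= k)%N -> enorm (\sum_(n <= i < j) v i) <= B) ->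
  (n <= k)%N -> enorm (\sum_(n <= i < k) b i *: v i) <= b n * B.
Proof.
move=> b0 bS vB nk.
(* The discrepancy telescopes: each step adds a decrease of the weights times a
   partial sum. *)
have key j : (n <= j)%N -> (j <= k)%N ->
    enorm (\sum_(n <= i < j) b i *: v i - b j *: \sum_(n <= i < j) v i)
      <= (b n - b j) * B.
  elim: j => [|j IH].
    rewrite leqn0 => /eqP -> _.
    by rewrite !big_geq // scaler0 subr0 subrr mul0r enorm0.
  rewrite leq_eqVlt => /predU1P[<- _|nj jk].
    by rewrite !big_geq // scaler0 subr0 subrr mul0r enorm0.
  have {}nj : (n <= j)%N by [].
  rewrite big_nat_recr //=.
  have -> : \sum_(n <= i < j) b i *: v i + b j *: v j
        - b j.+1 *: \sum_(n <= i < j.+1) v i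
      = (\sum_(n <= i < j) b i *: v i - b j *: \sum_(n <= i < j) v i)
        + (b j - b j.+1) *: \sum_(n <= i < j.+1) v i.
    rewrite scalerBl [in X in _ + (X - _)]big_nat_recr //= scalerDr.
    by rewrite -!addrA; congr (_ + _); rewrite !addrA addNr add0r.
  apply: (le_trans (enormD _ _)).
  have h1 := IH nj (ltnW jk).
  have bj : 0 <= b j - b j.+1 by rewrite subr_ge0 bS // nj.
  have h2 : enorm ((b j - b j.+1) *: \sum_(n <= i < j.+1) v i) <= (b j - b j.+1) * B.
    by rewrite enormZ ger0_norm // ler_wpM2l // vB // jk andbT ltnW.
  lra.
rewrite -[\sum_(n <= i < k) _](subrK (b k *: \sum_(n <= i < k) v i)).
apply: (le_trans (enormD _ _)).
have h1 := key k nk (leqnn k).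
have h2 : enorm (b k *: \sum_(n <= i < k) v i) <= b k * B.
  have bk : 0 <= b k by rewrite b0 // nk leqnn.
  by rewrite enormZ ger0_norm // ler_wpM2l // vB // nk leqnn.
lra.
Qed.

Lemma limn_esup_near_lt (u : nat -> \bar R) (l : \bar R) :
  (limn_esup u < l)%E -> \forall n \near \oo, (u n < l)%E.
Proof.
rewrite /limn_esup limf_esupE => /ereal_inf_lt[_ [V Vn <-]] h.
apply: filterS Vn => n Vn; apply: le_lt_trans h.
by apply: ereal_sup_ubound; exists n.
Qed.

Lemma limn_esup_le_near (u : nat -> \bar R) (l : \bar R) :
  (\forall n \near \oo, (u n <= l)%E) -> (limn_esup u <= l)%E.
Proof.
move=> ul; rewrite /limn_esup limf_esupE.
apply: (@le_trans _ _ (ereal_sup [set u n | n in [set n | (u n <= l)%E]])).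
  by apply: ereal_inf_lbound; exists [set n | (u n <= l)%E].
by apply: ge_ereal_sup => _ [n /= un <-].
Qed.

Variable alpha : nat -> R.

Lemma noise_limsup_ge0 r (w : nat -> 'rV[R]_d) : (0 <= noise_limsup alpha r w)%E.
Proof.
apply: limf_esup_ge0 => [[N _ /(_ N)]|n]; first by apply => /=.
by rewrite lee_fin bigmax_ge_id.
Qed.

Hypothesis alpha_gt0 : forall n, 0 < alpha n.
Hypothesis alpha_sum : (\sum_(0 <= n <oo) (alpha n)%:E = +oo)%E.
Local Notation gamma := (gamma alpha).

(** The weights [gamma i `^ r] of the noise condition are undone by the
    decreasing weights [gamma i `^ (- r)], the largest of which is that of the
    first index of the window. *)
Lemma window_noise_le (r om : R) (w : nat -> 'rV[R]_d) : 0 < r ->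
  (noise_limsup alpha r w < om%:E)%E ->
  \forall N \near \oo, forall n k, (N <= n <= k)%N -> gamma k - gamma n <= 1 ->
    enorm (\sum_(n <= i < k) alpha i *: w i) <= om * gamma n `^ (- r).
Proof.
move=> r0 /limn_esup_near_lt [N1 _ HN1].
have [N2 _ HN2] := gamma_near_gt alpha_gt0 alpha_sum 0.
exists (maxn N1 N2) => // N /=; rewrite geq_max => /andP[N1N N2N].
move=> n k /andP[Nn nk] k1.
have N1n := leq_trans N1N Nn.
have g0 i : (n <= i)%N -> 0 < gamma i.
  by move=> ni; apply: HN2; rewrite /= (leq_trans N2N) // (leq_trans Nn).
have -> : \sum_(n <= i < k) alpha i *: w i =
    \sum_(n <= i < k) gamma i `^ (- r) *: ((alpha i * gamma i `^ r) *: w i).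
  apply: eq_big_nat => i /andP[ni _].
  rewrite scalerA powRN mulrCA mulrA mulfVK //.
  by rewrite gt_eqF // powR_gt0 // g0.
rewrite mulrC; apply: enorm_sum_weighted_le => // [i _|i /andP[ni _]|j /andP[nj jk]].
- exact: powR_ge0.
- rewrite !powRN lef_pV2 ?posrE ?powR_gt0 ?g0 ?(leqW ni) //.
  by apply: ge0_ler_powR; rewrite ?nnegrE ?(ltW r0) ?ltW ?g0 ?(leqW ni) // gammaS ltrDl.
have om_ub := HN1 n N1n; rewrite /= lte_fin in om_ub.
move: nj; rewrite leq_eqVlt => /predU1P[<-|].
  rewrite big_geq // enorm0 ltW // (le_lt_trans _ om_ub) //.
  exact: bigmax_ge_id.
case: j jk => // j jk nj; apply: ltW; apply: le_lt_trans om_ub.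
have jw : (j < window_end alpha n 1)%N.
  apply: ltn_window_end => //; apply: le_trans k1; rewrite lerD2r.
  exact: le_gamma.
apply: (@bigmax_sup_seq _ _ _ _ _ j) => //.
by rewrite mem_index_iota; apply/andP.
Qed.

End Noise.

(** * The trajectory over one window *)

Section OneWindow.
Context {R : realType} {d : nat}.
Variables (f : 'rV[R]_d -> R) (alpha : nat -> R) (theta w : nat -> 'rV[R]_d).
Hypothesis df : forall x, differentiable f x.
Hypothesis alpha_gt0 : forall n, 0 < alpha n.
Hypothesis rec : forall n,
  theta n.+1 = theta n - alpha n *: (grad f (theta n) + w n).
Local Notation gamma := (gamma alpha).
Local Notation G n := (enorm (grad f (theta n))).

Lemma iterate_sub n k : (n <= k)%N -> theta k - theta n =
  - (\sum_(n <= i < k) alpha i *: grad f (theta i))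
  - \sum_(n <= i < k) alpha i *: w i.
Proof.
elim: k => [|k IH].
  by rewrite leqn0 => /eqP ->; rewrite !big_geq // subrr oppr0 addr0.
rewrite leq_eqVlt => /predU1P[<-|nk].
  by rewrite !big_geq // subrr oppr0 addr0.
rewrite !big_nat_recr //= rec addrAC IH // scalerDr !opprD.
by rewrite -!addrA; congr (_ + _); rewrite addrCA.
Qed.

Variables (n k : nat) (c eta : R).
Hypothesis nk : (n <= k)%N.
Hypothesis c_gt0 : 0 < c.
Local Notation s := (gamma k - gamma n).
Hypothesis short : s * c <= 16^-1.
Hypothesis noise : forall j, (n <= j <= k)%N ->
  enorm (\sum_(n <= i < j) alpha i *: w i) <= eta.
Hypothesis lip : forall j t, (n <= j <= k)%N -> 0 <= t <= 1 ->
  enorm (grad f (theta n + t *: (theta j - theta n)) - grad f (theta n))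
    <= c * (t * enorm (theta j - theta n)).

Let s_ge0 : 0 <= s. Proof. by rewrite subr_ge0 le_gamma. Qed.
Let eta_ge0 : 0 <= eta.
Proof. by have := noise (j := n); rewrite leqnn nk big_geq // enorm0; apply. Qed.
Let G_ge0 : 0 <= G n. Proof. exact: enorm_ge0. Qed.

Let lip1 j : (n <= j <= k)%N ->
  enorm (grad f (theta j) - grad f (theta n)) <= c * enorm (theta j - theta n).
Proof.
move=> nj; have := lip nj (t := 1).
by rewrite ler01 lexx scale1r mul1r [theta n + _]addrC subrK; apply.
Qed.

(** The gradients met along the window differ from the first one by at most [c]
    times the displacement, so the bound reproduces itself; [1 / 10] absorbs the
    factor [s * c <= 1 / 16] of this feedback. *)
Lemma window_displacement j : (n <= j <= k)%N ->
  enorm (theta j - theta n) <= 11 / 10 * (s * G n + eta).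
Proof.
elim/ltn_ind: j => j IH /andP[nj jk].
rewrite iterate_sub //; apply: (le_trans (enormB _ _)); rewrite enormN.
have h1 : enorm (\sum_(n <= i < j) alpha i *: w i) <= eta by rewrite noise // nj.
have h2 : enorm (\sum_(n <= i < j) alpha i *: grad f (theta i))
    <= s * (G n + c * (11 / 10 * (s * G n + eta))).
  apply: (le_trans (enorm_sum _ _)).
  apply: (@le_trans _ _ (\sum_(n <= i < j)
      alpha i * (G n + c * (11 / 10 * (s * G n + eta))))).
    apply: ler_sum_nat => i /andP[ni ij].
    rewrite enormZ gtr0_norm // ler_pM2l //.
    have nik : (n <= i <= k)%N by rewrite ni (leq_trans (ltnW ij)).
    rewrite -[grad f (theta i)](subrK (grad f (theta n))) addrC.
    apply: (le_trans (enormD _ _)); rewrite lerD2l.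
    by apply: (le_trans (lip1 nik)); rewrite ler_pM2l // IH.
  rewrite -mulr_suml -gammaB // ler_wpM2r //.
    by rewrite addr_ge0 // mulr_ge0 ?mulr_ge0 ?addr_ge0 ?mulr_ge0 // ltW.
  by rewrite lerD2r le_gamma.
have h3 : s * c * (s * G n + eta) <= 16^-1 * (s * G n + eta).
  by rewrite ler_wpM2r // addr_ge0 // mulr_ge0.
have e0 := eta_ge0; have := mulr_ge0 s_ge0 G_ge0; lra.
Qed.

Lemma window_drift : enorm (theta k - theta n + s *: grad f (theta n))
  <= 11 / 10 * (c * s ^+ 2 * G n + eta).
Proof.
have -> : theta k - theta n + s *: grad f (theta n) =
    - (\sum_(n <= i < k) alpha i *: (grad f (theta i) - grad f (theta n)))
    - \sum_(n <= i < k) alpha i *: w i.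
  rewrite iterate_sub // addrAC; congr (_ - _).
  under [in RHS]eq_bigr do rewrite scalerBr.
  by rewrite sumrB opprB -scaler_suml -gammaB // addrC.
apply: (le_trans (enormB _ _)); rewrite enormN.
have h1 : enorm (\sum_(n <= i < k) alpha i *: w i) <= eta.
  by rewrite noise // nk leqnn.
have h2 : enorm (\sum_(n <= i < k) alpha i *: (grad f (theta i) - grad f (theta n)))
    <= s * (c * (11 / 10 * (s * G n + eta))).
  apply: (le_trans (enorm_sum _ _)); rewrite [leRHS]mulrC gammaB // mulr_sumr.
  apply: ler_sum_nat => i /andP[ni ij].
  rewrite enormZ gtr0_norm // [leRHS]mulrC ler_pM2l //.
  have nik : (n <= i <= k)%N by rewrite ni ltnW.
  by apply: (le_trans (lip1 nik)); rewrite ler_pM2l // -gammaB // window_displacement.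
have h3 : s * c * eta <= 16^-1 * eta by rewrite ler_wpM2r.
have e0 := eta_ge0; lra.
Qed.

(** The gradient step over a window of length [s] lowers [f] by about
    [s * G n ^+ 2]; curvature spoils at most a quarter of it on a short window,
    and the remaining terms are due to the noise. *)
Lemma window_value : f (theta k) - f (theta n)
  <= - (3 / 4) * s * G n ^+ 2 + 11 / 10 * G n * eta + 5 / 2 * c * eta ^+ 2.
Proof.
have nkk : (n <= k <= k)%N by rewrite nk leqnn.
rewrite -[theta k in X in X <= _](subrK (theta n)) addrC [_ - _ + theta n]addrC.
rewrite addrC; apply: (le_trans (descent_bound df (c := c) _ (ltW c_gt0))).
  by move=> t t01; exact: lip.
have -> : dot (grad f (theta n)) (theta k - theta n) =
    - s * G n ^+ 2 + dot (grad f (theta n)) (theta k - theta n + s *: grad f (theta n)).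
  by rewrite [in RHS]dotDr dotZr dotxx; ring.
have h1 := le_trans (dot_le_enorm (grad f (theta n)) _)
  (ler_wpM2l G_ge0 window_drift).
have h2 : enorm (theta k - theta n) ^+ 2 <= (11 / 10 * (s * G n + eta)) ^+ 2.
  rewrite ler_sqr ?nnegrE ?enorm_ge0 ?window_displacement //.
  by rewrite mulr_ge0 // addr_ge0 // mulr_ge0.
have h3 : c * enorm (theta k - theta n) ^+ 2
    <= c * (121 / 50 * (s ^+ 2 * G n ^+ 2 + eta ^+ 2)).
  rewrite ler_pM2l //; apply: (le_trans h2).
  have := sqr_ge0 (s * G n - eta); nra.
have h4 : s * c * (s * G n ^+ 2) <= 16^-1 * (s * G n ^+ 2).
  by rewrite ler_wpM2r // mulr_ge0 // sqr_ge0.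
have h5 : 0 <= s * G n ^+ 2 by rewrite mulr_ge0 // sqr_ge0.
have h6 : 0 <= c * eta ^+ 2 by rewrite mulr_ge0 ?(ltW c_gt0) // sqr_ge0.
lra.
Qed.

Lemma window_rise : f (theta k) - f (theta n)
  <= 11 / 10 * G n * eta + 5 / 2 * c * eta ^+ 2.
Proof.
apply: (le_trans window_value); have h : 0 <= s * G n ^+ 2.
  by rewrite mulr_ge0 // sqr_ge0.
lra.
Qed.

Lemma window_decrease : 0 < s ->
  f (theta k) - f (theta n) <= - (s / 2) * G n ^+ 2 + 2 / s * eta ^+ 2.
Proof.
move=> s0; apply: (le_trans window_value).
(* Young's inequality, with a weight that leaves half of the decrease. *)
have young : 11 / 10 * G n * eta <= s / 4 * G n ^+ 2 + 121 / 100 / s * eta ^+ 2.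
  rewrite -subr_ge0.
  have -> : s / 4 * G n ^+ 2 + 121 / 100 / s * eta ^+ 2 - 11 / 10 * G n * eta
     = (s / 2 * G n - 11 / 10 * eta) ^+ 2 / s by field; rewrite gt_eqF.
  by rewrite divr_ge0 // sqr_ge0.
have h : c * eta ^+ 2 <= 16^-1 / s * eta ^+ 2.
  by rewrite ler_wpM2r ?sqr_ge0 // ler_pdivlMr // mulrC.
have : 0 <= s^-1 * eta ^+ 2 by rewrite mulr_ge0 ?invr_ge0 ?sqr_ge0.
lra.
Qed.

End OneWindow.

(** * Convergence of the values and of the gradients *)

Section PowerAsymptotics.
Context {R : realType}.

Lemma powR_eventually_le (A B a b : R) : 0 < A -> a < b ->
  exists2 T, 0 < T & forall t, T <= t -> B * t `^ (- b) <= A * t `^ (- a).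
Proof.
move=> A0 ab; have ba : 0 < b - a by rewrite subr_gt0.
pose T := (`|B| / A + 1) `^ (b - a)^-1.
have T0 : 0 < T by rewrite powR_gt0 // ltr_wpDl // divr_ge0 // ltW.
exists T => // t Tt; have t0 : 0 < t by exact: lt_le_trans Tt.
have -> : - b = - a + - (b - a) by ring.
rewrite powRD; last by rewrite (gt_eqF t0) implybT.
rewrite mulrCA mulrC ler_pM2r ?powR_gt0 // powRN ler_pdivrMr ?powR_gt0 //.
apply: (le_trans (ler_norm _)); rewrite mulrC -ler_pdivrMr //.
have : T `^ (b - a) <= t `^ (b - a).
  by apply: ge0_ler_powR => //; rewrite ?nnegrE ltW.
rewrite /T -powRrM mulVf ?gt_eqF // powRr1; first by apply: le_trans; rewrite lerDl.
by rewrite addr_ge0 // divr_ge0 // ltW.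
Qed.

Lemma powRN_eventually_le (B b e : R) : 0 < e -> 0 < b ->
  exists2 T, 0 < T & forall t, T <= t -> B * t `^ (- b) <= e.
Proof.
move=> e0 b0; have [T T0 HT] := @powR_eventually_le e B 0 b e0 b0.
by exists T => // t /HT; rewrite oppr0 powRr0 mulr1.
Qed.

End PowerAsymptotics.

Section Trajectory.
Context {R : realType} {d : nat}.
Variables (f : 'rV[R]_d -> R) (alpha : nat -> R) (theta w : nat -> 'rV[R]_d).
Variables (r om : R).
Hypothesis df : forall x, differentiable f x.
Hypothesis alpha_gt0 : forall n, 0 < alpha n.
Hypothesis alpha_cvg0 : alpha @ \oo --> 0.
Hypothesis alpha_sum : (\sum_(0 <= n <oo) (alpha n)%:E = +oo)%E.
Hypothesis rec : forall n,
  theta n.+1 = theta n - alpha n *: (grad f (theta n) + w n).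
Hypothesis r_gt0 : 0 < r.
Hypothesis noise_lt : (noise_limsup alpha r w < om%:E)%E.
Local Notation gamma := (gamma alpha).
Local Notation G n := (enorm (grad f (theta n))).
Local Notation eta n := (om * gamma n `^ (- r)).

Lemma gamma_eventually (P : R -> Prop) :
  (exists2 T, 0 < T & forall t, T <= t -> P t) ->
  \forall N \near \oo, forall n, (N <= n)%N -> P (gamma n).
Proof.
case=> T _ HT; have [N0 _ HN0] := gamma_near_ge alpha_gt0 alpha_sum T.
exists N0 => // N N0N n Nn; apply/HT/HN0 => /=; exact: leq_trans Nn.
Qed.

Lemma eta_near_le (e : R) : 0 < e ->
  \forall N \near \oo, forall n, (N <= n)%N -> eta n <= e.
Proof.
move=> e0; apply: (gamma_eventually (P := fun t => om * t `^ (- r) <= e)).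
exact: powRN_eventually_le.
Qed.

Lemma om_gt0 : 0 < om.
Proof. by rewrite -lte_fin (le_lt_trans (noise_limsup_ge0 alpha r w)). Qed.

Lemma eta_ge0 n : 0 <= eta n.
Proof. by rewrite mulr_ge0 ?powR_ge0 // ltW // om_gt0. Qed.

(** The analysis of a window evaluates the gradient only on the chords issued
    from its first iterate, so a Lipschitz constant along these chords suffices
    and no convex domain has to be chosen. Over time distances up to
    [(16 * c)^-1] the curvature is harmless. *)
Definition chord_lipschitz (c : R) : Prop :=
  \forall N \near \oo, forall n j t, (N <= n <= j)%N ->
    gamma j - gamma n <= (16 * c)^-1 -> 0 <= t <= 1 ->
    enorm (grad f (theta n + t *: (theta j - theta n)) - grad f (theta n))
      <= c * (t * enorm (theta j - theta n)).

Section FixedConstant.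
Variable c : R.
Hypothesis c_ge1 : 1 <= c.
Hypothesis lip : chord_lipschitz c.

Let c_gt0 : 0 < c. Proof. exact: lt_le_trans c_ge1. Qed.

Let tau_le1 : (16 * c)^-1 <= 1.
Proof. by rewrite invf_le1 ?mulr_gt0 //; have := c_ge1; lra. Qed.

Lemma late_rise : \forall N \near \oo, forall n k, (N <= n <= k)%N ->
  gamma k - gamma n <= (16 * c)^-1 ->
  f (theta k) - f (theta n) <= 11 / 10 * G n * eta n + 5 / 2 * c * eta n ^+ 2.
Proof.
apply: filterS2 lip (window_noise_le alpha_gt0 alpha_sum r_gt0 noise_lt).
move=> N HL HN n k /andP[Nn nk] kn.
have sub j : (n <= j <= k)%N -> gamma j - gamma n <= gamma k - gamma n.
  by case/andP=> _ jk; rewrite lerD2r le_gamma.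
apply: (window_rise df alpha_gt0 rec nk c_gt0).
- by rewrite -ler_pdivlMr // -invfM.
- move=> j nj; apply: HN; first by rewrite Nn; case/andP: nj.
  by apply: le_trans tau_le1; apply: le_trans kn; exact: sub.
- move=> j t nj; apply: HL; first by rewrite Nn; case/andP: nj.
  by apply: le_trans kn; exact: sub.
Qed.

Lemma late_decrease : \forall N \near \oo, forall n k, (N <= n <= k)%N ->
  (32 * c)^-1 <= gamma k - gamma n <= 2 * (32 * c)^-1 ->
  f (theta k) - f (theta n)
    <= - ((64 * c)^-1 * G n ^+ 2) + 64 * c * eta n ^+ 2.
Proof.
apply: filterS2 lip (window_noise_le alpha_gt0 alpha_sum r_gt0 noise_lt).
move=> N HL HN n k /andP[Nn nk] /andP[nk1 nk2].
have kn : gamma k - gamma n <= (16 * c)^-1.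
  apply: (le_trans nk2); rewrite le_eqVlt; apply/orP; left; apply/eqP.
  by field; rewrite gt_eqF.
have sub j : (n <= j <= k)%N -> gamma j - gamma n <= gamma k - gamma n.
  by case/andP=> _ jk; rewrite lerD2r le_gamma.
have s0 : 0 < gamma k - gamma n.
  by apply: lt_le_trans nk1; rewrite invr_gt0 mulr_gt0.
apply: (le_trans (window_decrease df alpha_gt0 rec nk c_gt0 (eta := eta n) _ _ _ s0)).
- by rewrite -ler_pdivlMr // -invfM.
- move=> j nj; apply: HN; first by rewrite Nn; case/andP: nj.
  by apply: le_trans tau_le1; apply: le_trans kn; exact: sub.
- move=> j t nj; apply: HL; first by rewrite Nn; case/andP: nj.
  by apply: le_trans kn; exact: sub.
apply: lerD.
  rewrite mulNr lerN2 ler_wpM2r ?sqr_ge0 //.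
  have -> : (64 * c)^-1 = (32 * c)^-1 / 2 by field; rewrite gt_eqF.
  by rewrite ler_pM2r // invr_gt0.
rewrite ler_wpM2r ?sqr_ge0 // ler_pdivrMr // -ler_pdivrMl ?mulr_gt0 //.
by have -> : (64 * c)^-1 * 2 = (32 * c)^-1 by field; rewrite gt_eqF.
Qed.

Lemma late_window_ind : \forall N \near \oo, forall P : nat -> Prop,
  (forall n, (N <= n)%N -> gamma n - gamma N < (32 * c)^-1 -> P n) ->
  (forall m n, (N <= m < n)%N ->
     (32 * c)^-1 <= gamma n - gamma m <= 2 * (32 * c)^-1 -> P m -> P n) ->
  forall n, (N <= n)%N -> P n.
Proof. by apply: window_ind => //; rewrite invr_gt0 mulr_gt0. Qed.

Lemma late_window_after : \forall N \near \oo, forall n, (N <= n)%N ->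
  exists2 k, (n <= k)%N &
    (32 * c)^-1 <= gamma k - gamma n <= 2 * (32 * c)^-1.
Proof. by apply: window_after => //; rewrite invr_gt0 mulr_gt0. Qed.

Section Convergence.
Variables (fl delta mu M : R).
Hypothesis grad_bound : forall n, G n <= c.
Hypothesis fl_lower : forall e, 0 < e -> \forall n \near \oo, fl - e < f (theta n).
Hypothesis fl_frequent : forall e N, 0 < e ->
  exists2 n, (N <= n)%N & f (theta n) < fl + e.
Hypothesis delta_gt0 : 0 < delta.
Hypothesis mu_gt0 : 0 < mu.
Hypothesis M_ge1 : 1 <= M.
Hypothesis loj : forall n, `|f (theta n) - fl| <= delta ->
  `|f (theta n) - fl| <= M * G n `^ mu.

(** Once the noise is negligible, [f] strictly decreases over every window
    started where [f] exceeds the limit inferior by an amount at which the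
    Lojasiewicz inequality forbids a small gradient; so [f] cannot climb back
    after a visit near its limit inferior. *)
Lemma value_near_le (e : R) : 0 < e ->
  \forall n \near \oo, f (theta n) - fl <= e.
Proof.
move=> e0; pose e' := Num.min e delta / 2.
have e'0 : 0 < e' by rewrite divr_gt0 // lt_min e0.
have [e'e e'd] : 2 * e' <= e /\ 2 * e' <= delta.
  by rewrite /e' mulrC mulfVK ?pnatr_eq0 // !ge_min !lexx orbT.
have M0 : 0 < M by exact: lt_le_trans M_ge1.
pose g0 := (e' / M) `^ mu^-1.
have g00 : 0 < g0 by rewrite powR_gt0 // divr_gt0.
(* Below the first noise level the decrease forced by the gradient bound [g0]
   wins over the noise, below the second one [f] rises by at most [e'] over a
   window. *)
have h1 : 0 < g0 / (64 * c) by rewrite divr_gt0 // mulr_gt0.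
have h2 : 0 < e' / (4 * c) by rewrite divr_gt0 // mulr_gt0.
have [N0 _ H0] := filterI (filterI late_window_ind
  (filterI late_rise late_decrease)) (filterI (eta_near_le ltr01)
  (filterI (eta_near_le h1) (eta_near_le h2))).
have [N NN0 HN] := fl_frequent N0 e'0.
have {H0} [[ind [rise decr]] [eta1 [etag etae]]] := H0 N NN0.
have small n k : (N <= n <= k)%N -> gamma k - gamma n <= (16 * c)^-1 ->
    f (theta k) - f (theta n) <= e'.
  move=> /[dup] nk /andP[Nn _] kn; apply: (le_trans (rise n k nk kn)).
  have := eta1 n Nn; have := etae n Nn; rewrite ler_pdivlMr ?mulr_gt0 //.
  have := eta_ge0 n; have := grad_bound n; move: (eta n) (G n) => x g gc x0 xe x1.
  have : g * x <= c * x by rewrite ler_wpM2r.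
  have : c * x ^+ 2 <= c * x by rewrite ler_pM2l // expr2 ler_piMr.
  lra.
have s16 : (32 * c)^-1 <= (16 * c)^-1.
  by rewrite lef_pV2 ?posrE ?mulr_gt0 // ler_pM2r // ler_nat.
have s216 : 2 * (32 * c)^-1 <= (16 * c)^-1.
  by rewrite le_eqVlt; apply/orP; left; apply/eqP; field; rewrite gt_eqF.
exists N => // n /= Nn; apply: le_trans e'e.
apply: (ind (fun n => f (theta n) - fl <= 2 * e') _ _ n Nn).
  move=> k Nk kN; have := small N k; rewrite leqnn Nk => /(_ isT).
  by move=> /(_ (ltW (lt_le_trans kN s16))); lra.
move=> m k /andP[Nm mk] win um.
have mk' : (N <= m <= k)%N by rewrite Nm ltnW.
have [ume|ume] := leP (f (theta m) - fl) e'.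
  have := small m k mk'; case/andP: win => _ w2 /(_ (le_trans w2 s216)); lra.
have absE : `|f (theta m) - fl| = f (theta m) - fl.
  by rewrite ger0_norm // ltW // (lt_trans e'0).
have Gg0 : g0 <= G m.
  have : e' / M <= G m `^ mu.
    rewrite ler_pdivrMr // mulrC; apply: le_trans (ltW ume) _.
    by rewrite -absE loj // absE (le_trans um).
  rewrite /g0 => h.
  rewrite -[leRHS](powRr1 (enorm_ge0 _)) -(mulfV (lt0r_neq0 mu_gt0)) powRrM.
  apply: ge0_ler_powR => //; rewrite ?nnegrE ?invr_ge0 ?powR_ge0 ?(ltW mu_gt0) //.
  by rewrite divr_ge0 // ltW.
apply: le_trans um; rewrite lerD2r -subr_le0.
apply: (le_trans (decr m k mk' win)).
have := etag m Nm; have := eta_ge0 m.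
move: (eta m) (G m) Gg0 => x g gg x0; rewrite ler_pdivlMr ?mulr_gt0 // => xg.
rewrite addrC subr_le0 ler_pdivlMl ?mulr_gt0 //.
have -> : 64 * c * (64 * c * x ^+ 2) = (x * (64 * c)) ^+ 2 by ring.
rewrite ler_sqr ?nnegrE //; first exact: le_trans gg.
  by rewrite mulr_ge0 // mulr_ge0 // ltW.
exact: le_trans (ltW g00) gg.
Qed.

Lemma value_cvg (e : R) : 0 < e -> \forall n \near \oo, `|f (theta n) - fl| <= e.
Proof.
move=> e0; apply: filterS2 (value_near_le e0) (fl_lower e0) => n h1 h2.
by rewrite ler_norml h1 andbT lerBrDr addrC ltW.
Qed.

(** A gradient that does not tend to zero would make the convergent values drop by
    a fixed amount over some arbitrarily late windows. *)
Lemma gradient_cvg0 (e : R) : 0 < e -> \forall n \near \oo, G n <= e.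
Proof.
move=> e0; pose k := 64 * c; have k0 : 0 < k by rewrite mulr_gt0.
pose e' := e ^+ 2 / (3 * k).
have e'0 : 0 < e' by rewrite divr_gt0 ?exprn_gt0 ?mulr_gt0.
have h1 : 0 < e' / k by rewrite divr_gt0.
have [N _ HN] := filterI (filterI (value_cvg e'0) late_window_after)
  (filterI (late_decrease) (filterI (eta_near_le ltr01) (eta_near_le h1))).
exists N => // n Nn; have [[un succ] [decr [eta1 etae]]] := HN n Nn.
have [m nm win] := succ n (leqnn n).
have [[um _] _] := HN m (leq_trans Nn nm).
have := decr n m; rewrite leqnn nm => /(_ isT win).
have := eta1 n (leqnn n); have := etae n (leqnn n); have := eta_ge0 n.
move: un um; rewrite !ler_norml => /andP[_ un] /andP[um _].
rewrite -/k ler_pdivlMr // => x0 xe x1 D.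
have : k * eta n ^+ 2 <= e'.
  by apply: le_trans xe; rewrite mulrC ler_pM2r // expr2 ler_piMr.
move: x0 xe x1 D; move: (eta n) => x x0 xe x1 D xe'.
have : k^-1 * G n ^+ 2 <= 3 * e' by lra.
rewrite ler_pdivrMl // /e'.
have -> : k * (3 * (e ^+ 2 / (3 * k))) = e ^+ 2 by field; rewrite gt_eqF.
by rewrite ler_sqr ?nnegrE ?enorm_ge0 // ltW.
Qed.

End Convergence.
End FixedConstant.
End Trajectory.

(** * Comparison of a window recursion with a barrier *)

Section RateComparison.
Context {R : realType}.

Lemma powRN_shift_ge (p t h : R) : 0 <= p -> 0 < t -> 0 <= h ->
  t `^ (- p) * (1 - p * (h / t)) <= (t + h) `^ (- p).
Proof.
move=> p0 t0 h0; have z0 : 0 <= h / t by rewrite divr_ge0 // ltW.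
have -> : t + h = t * (1 + h / t) by field; rewrite gt_eqF.
rewrite powRM ?(ltW t0) ?addr_ge0 // ler_pM2l ?powR_gt0 //.
rewrite /powR gt_eqF; last by rewrite ltr_wpDr.
apply: le_trans (expR_ge1Dx _); rewrite lerD2l mulNr lerN2 ler_wpM2l //.
by apply: le_ln1Dx; apply: lt_le_trans z0; rewrite ltrN10.
Qed.

Variable alpha : nat -> R.
Hypothesis alpha_gt0 : forall n, 0 < alpha n.
Hypothesis alpha_cvg0 : alpha @ \oo --> 0.
Hypothesis alpha_sum : (\sum_(0 <= n <oo) (alpha n)%:E = +oo)%E.
Local Notation gamma := (gamma alpha).

Variables (u : nat -> R) (s kappa q b r2 A p L0 : R).
Hypothesis s_gt0 : 0 < s.
Hypothesis s_le : 2 * s <= 1.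
Hypothesis kappa_gt0 : 0 < kappa.
Hypothesis q_ge1 : 1 <= q.
Hypothesis A_gt0 : 0 < A.
Hypothesis p_ge0 : 0 <= p.
Hypothesis L0_ge3p : 3 * p <= L0.
Hypothesis L0_gep1 : p + 1 <= L0.
Local Notation x := (fun t : R => A * t `^ (- p)).
Local Notation B := (fun t : R => b * t `^ (- r2)).
Hypothesis u_cvg0 : forall e : R, 0 < e -> \forall n \near \oo, `|u n| <= e.
Hypothesis u_rec : \forall N \near \oo, forall n k, (N <= n <= k)%N ->
  s <= gamma k - gamma n <= 2 * s ->
  u k <= u n - kappa * `|u n| `^ q + B (gamma n).
(** In the window recursion for [u], the barrier [x] makes the decrease
    dominate both the noise term and the decrease rate [p / t] of [x] itself. *)
Hypothesis barrier : exists2 T : R, 0 < T & forall t : R, T <= t ->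
  [/\ B t <= kappa * x t `^ q, L0 / t <= kappa * x t `^ (q - 1) & B t <= x t].

Let x_gt0 (t : R) : 0 < t -> 0 < x t.
Proof. by move=> t0; rewrite mulr_gt0 // powR_gt0. Qed.

Let x_le (t t' : R) : 0 < t -> t <= t' -> x t' <= x t.
Proof.
move=> t0 tt'; rewrite ler_pM2l // !powRN lef_pV2 ?posrE ?powR_gt0 //.
  by apply: ge0_ler_powR => //; rewrite ?nnegrE ltW // (lt_le_trans t0).
exact: lt_le_trans tt'.
Qed.

Let powR_pred (z : R) : 0 < z -> z `^ q = z `^ (q - 1) * z.
Proof.
move=> z0; rewrite -{3}(powRr1 (ltW z0)) -powRD ?subrK //.
by rewrite (gt_eqF z0) implybT.
Qed.

(** The power [q] is replaced by a secant through the barrier, which turns the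
    window recursion into a linear one contracting towards [2 * x]. *)
Lemma linear_step (t v : R) : 0 < t -> L0 <= t -> B t <= kappa * x t `^ q ->
  L0 / t <= kappa * x t `^ (q - 1) -> B t <= x t ->
  exists2 lam, L0 / t <= lam <= 1 &
    v - kappa * `|v| `^ q + B t <= (1 - lam) * v + 2 * lam * x t.
Proof.
move=> t0 Lt ha hb hc; pose lam := Num.min 1 (kappa * x t `^ (q - 1)).
have L00 : 0 <= L0 by have := p_ge0; have := L0_gep1; lra.
have x0 := x_gt0 t0; have lam0 : 0 <= lam.
  by rewrite le_min ler01 mulr_ge0 ?powR_ge0 ?(ltW kappa_gt0).
have laml : lam <= kappa * x t `^ (q - 1) by rewrite ge_min lexx orbT.
exists lam; first by rewrite le_min hb ge_min lexx ler_pdivrMr // mul1r Lt.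
have Blam : B t <= lam * x t.
  by rewrite /lam minr_pMl ?(ltW x0) // le_min mul1r hc -mulrA -powR_pred.
suff : lam * (v - x t) <= kappa * `|v| `^ q by move=> h; lra.
have [vx|xv] := leP v (x t).
  apply: (@le_trans _ _ 0); last by rewrite mulr_ge0 ?powR_ge0 ?(ltW kappa_gt0).
  by rewrite mulr_ge0_le0 // subr_le0.
have v0 : 0 < v by exact: lt_trans xv.
rewrite gtr0_norm // powR_pred // mulrA.
apply: (@le_trans _ _ (lam * v)); first by rewrite ler_wpM2l // gerBl ltW.
rewrite ler_pM2r //; apply: (le_trans laml); rewrite ler_pM2l //.
apply: ge0_ler_powR; rewrite ?nnegrE ?subr_ge0 //; exact: ltW.
Qed.

(** The sequence [3 * x] is a supersolution of the linear recursion of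
    [linear_step], and so is any multiple of a power decaying faster by one order;
    the latter absorbs the unknown initial values and is eventually negligible. *)
Lemma upper_rate : \forall n \near \oo, u n <= 4 * x (gamma n).
Proof.
have [T T0 HT] := barrier.
have [N _ HN] := filterI (filterI u_rec (window_ind alpha_cvg0 s_gt0))
  (filterI (u_cvg0 ltr01) (filterI (gamma_near_ge alpha_gt0 alpha_sum T)
    (gamma_near_ge alpha_gt0 alpha_sum L0))).
have [[rec ind] [_ [TN LN]]] := HN N (leqnn N).
(* The transient is at least one on the whole initial window, where [u] is at
   most one. *)
pose y t := (gamma N + 1) `^ (p + 1) * t `^ (- (p + 1)).
have main n : (N <= n)%N -> u n <= 3 * x (gamma n) + y (gamma n).
  move: n; apply: (ind (fun n => u n <= 3 * x (gamma n) + y (gamma n)))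
    => [k Nk kN|m k /andP[Nm mk] /andP[w1 w2] um].
    have gk : 0 < gamma k by apply: (lt_le_trans T0); exact: (le_trans TN (le_gamma _ Nk)).
    have [_ [uk1 _]] := HN k Nk.
    apply: (le_trans (ler_norm _)); apply: (le_trans uk1).
    have xk := x_gt0 gk.
    suff : 1 <= y (gamma k) by lra.
    rewrite /y powRN ler_pdivlMr ?powR_gt0 // mul1r.
    have p1 : 0 <= p + 1 by rewrite addr_ge0.
    apply: ge0_ler_powR => //; rewrite ?nnegrE ?(ltW gk) //.
      by have := le_gamma alpha_gt0 Nk; have := s_le; lra.
    have := s_le; lra.
  set t := gamma m in w1 w2 um *; pose h := gamma k - t.
  have tT : T <= t by apply: (le_trans TN); exact: le_gamma.
  have tL : L0 <= t by apply: (le_trans LN); exact: le_gamma.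
  have t0 : 0 < t by exact: lt_le_trans tT.
  have [Ba Bb Bc] := HT t tT.
  have [lam /andP[lam1 lam2] step] := linear_step (u m) t0 tL Ba Bb Bc.
  have h0 : 0 <= h by rewrite (le_trans (ltW s_gt0)).
  have h1 : h <= 1 by apply: (le_trans w2).
  have hlam a : 0 <= a <= L0 -> a * (h / t) <= lam.
    move=> /andP[a0 aL]; apply: le_trans lam1; rewrite mulrA ler_pM2r ?invr_gt0 //.
    by apply: le_trans aL; rewrite ler_piMr.
  have tk : gamma k = t + h by rewrite /h addrC subrK.
  have mk' : (N <= m <= k)%N by rewrite Nm ltnW.
  apply: (le_trans (rec m k mk' _)); first by rewrite w1.
  apply: (le_trans step); rewrite -/t tk.
  have xk : 3 * x t - lam * x t <= 3 * x (t + h).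
    have := hlam (3 * p); rewrite mulr_ge0 ?L0_ge3p ?p_ge0 // => /(_ isT) pl.
    have sh := powRN_shift_ge p_ge0 t0 h0.
    have : (3 * x t) * (1 - p * (h / t)) <= 3 * x (t + h).
      by rewrite -!mulrA ler_pM2l // ler_pM2l.
    have : 3 * p * (h / t) * x t <= lam * x t by rewrite ler_pM2r // x_gt0.
    lra.
  have yk : (1 - lam) * y t <= y (t + h).
    have p1 : 0 <= p + 1 by rewrite addr_ge0.
    have := hlam (p + 1); rewrite p1 L0_gep1 => /(_ isT) pl.
    have sh := powRN_shift_ge p1 t0 h0.
    have yt : 0 <= y t by rewrite mulr_ge0 ?powR_ge0.
    have : y t * (1 - (p + 1) * (h / t)) <= y (t + h).
      by rewrite -!mulrA ler_wpM2l ?powR_ge0.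
    have : (p + 1) * (h / t) * y t <= lam * y t by rewrite ler_wpM2r.
    lra.
  have : (1 - lam) * u m <= (1 - lam) * (3 * x t + y t).
    by rewrite ler_wpM2l // subr_ge0.
  lra.
have pp : p < p + 1 by rewrite ltrDl.
have [T' _ HT'] := powR_eventually_le ((gamma N + 1) `^ (p + 1)) A_gt0 pp.
have [N' _ HN'] := gamma_near_ge alpha_gt0 alpha_sum T'.
exists (maxn N N') => // n /=; rewrite geq_max => /andP[Nn N'n].
have := HT' _ (HN' n N'n); have := main n Nn; rewrite /y; lra.
Qed.

(** Below [- x] the decrease beats the noise, so [u] would keep decreasing from
    window to window and could not tend to zero. *)
Lemma lower_rate : \forall n \near \oo, - x (gamma n) <= u n.
Proof.
have [T T0 HT] := barrier.
have [N _ HN] := filterI (filterI u_rec (window_after alpha_gt0 alpha_cvg0 alpha_sum s_gt0))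
  (gamma_near_ge alpha_gt0 alpha_sum T).
exists N => // n Nn; have [[rec after] Tn] := HN n Nn.
rewrite leNgt; apply/negP => un.
have gn : 0 < gamma n by exact: lt_le_trans Tn.
have below j : exists2 k, (n + j <= k)%N & u k <= u n.
  elim: j => [|j [k jk ukn]]; first by exists n; rewrite ?addn0.
  have nk : (n <= k)%N by rewrite (leq_trans (leq_addr j n)).
  have [m km win] := after k nk.
  exists m.
    rewrite addnS (leq_ltn_trans jk) // ltn_neqAle km andbT.
    apply/eqP => E; move: win; rewrite -E subrr => /andP[+ _].
    by rewrite leNgt s_gt0.
  apply: (le_trans _ ukn).
  have gk : gamma n <= gamma k by exact: le_gamma.
  have gk0 : 0 < gamma k by exact: lt_le_trans gk.
  have [Ba _ _] := HT (gamma k) (le_trans Tn gk).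
  have uk : x (gamma k) <= `|u k|.
    rewrite ler0_norm; last by have := x_gt0 gn; lra.
    by have := x_le gn gk; lra.
  have : kappa * x (gamma k) `^ q <= kappa * `|u k| `^ q.
    rewrite ler_pM2l //; apply: ge0_ler_powR => //; rewrite ?nnegrE //.
      exact: le_trans q_ge1.
    exact: ltW (x_gt0 gk0).
  have nkm : (n <= k <= m)%N by rewrite nk.
  by have := rec k m nkm win; lra.
have un0 : 0 < - u n by have := x_gt0 gn; lra.
have [N2 _ HN2] := u_cvg0 (divr_gt0 un0 (ltr0n R 2)).
have [k nk ukn] := below N2.
have := HN2 k (leq_trans (leq_addl _ _) nk); rewrite /= ler_norml => /andP[+ _].
lra.
Qed.

End RateComparison.

(** * Choice of the barrier *)

Section Barrier.
Context {R : realType}.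
Variable r : R.
Hypothesis r_gt0 : 0 < r.

(** The three regimes of the rate, according to whether the noise decays more
    slowly than, as fast as, or faster than the error of the noise-free
    gradient descent. *)
Variant rate_spec (mu : R) : R -> (R -> R) -> Prop :=
  | RateNoise of r * (2 - mu) < 1 : rate_spec mu r id
  | RateBalanced of r * (2 - mu) = 1 : rate_spec mu r (fun x => 1 + x)
  | RateDescent of 1 < r * (2 - mu) : rate_spec mu (2 - mu)^-1 (fun=> 1).

Lemma rateP (mu : R) : mu <= 2 -> rate_spec mu (rate r mu) (phi r mu).
Proof.
rewrite le_eqVlt => /predU1P[->|mu2].
  have -> : rate r 2 = r by rewrite /rate /rhat ltxx /Order.min ltry.
  have -> : phi r 2 = id by apply/funext => x; rewrite /phi /rhat ltxx ltry.
  by apply: RateNoise; rewrite subrr mulr0.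
have m0 : 0 < 2 - mu by rewrite subr_gt0.
have rE : rhat mu = ((2 - mu)^-1)%:E by rewrite /rhat mu2.
have rateE : rate r mu = Num.min r (2 - mu)^-1.
  by rewrite /rate rE -EFin_min.
have phiE : phi r mu = fun x =>
    if r < (2 - mu)^-1 then x else if r == (2 - mu)^-1 then 1 + x else 1.
  by apply/funext => x; rewrite /phi rE lte_fin eqe.
rewrite rateE phiE; case: ltgtP => h.
- by apply: RateNoise; rewrite -ltr_pdivlMr // div1r.
- by apply: RateDescent; rewrite -ltr_pdivrMr // div1r.
- by apply: RateBalanced; rewrite h mulVf // gt_eqF.
Qed.

Lemma rate_gt0_le (mu : R) : mu <= 2 -> 0 < rate r mu <= r.
Proof.
move=> mu2; case: (rateP mu2) => [_|_|h]; rewrite ?r_gt0 ?lexx //.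
have m0 : 0 < 2 - mu by rewrite -(pmulr_rgt0 _ r_gt0) (lt_trans ltr01).
by rewrite invr_gt0 m0 /= -div1r ler_pdivrMr // ltW.
Qed.

Lemma phi_gt0 (mu x : R) : mu <= 2 -> 0 < x -> 0 < phi r mu x.
Proof. by move=> mu2 x0; case: (rateP mu2) => //= _; rewrite addr_gt0. Qed.

Lemma phi_ge0 (mu x : R) : mu <= 2 -> 0 <= x -> 0 <= phi r mu x.
Proof. by move=> mu2 x0; case: (rateP mu2) => //= _; rewrite addr_ge0. Qed.

(** In the window recursion
    [u k <= u n - kappa * `|u n| `^ q + 64 * c * eta n ^+ 2] for the excess [u]
    of [f] over its limit, with [q := 2 / mu], this is the coefficient of the
    decrease; [M ^+ 2] bounds the factor [M `^ q] uniformly in [mu]. *)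
Definition kappa (c M : R) := (64 * c * M ^+ 2)^-1.

(** Bounds, uniformly in [mu], the exponent [p + 1] of the transient and three
    times the exponent [p] of the barrier [x]: the supersolution is [3 * x], but
    its contraction only gains on the excess over [2 * x]. *)
Definition decay0 := 6 * r + 1.

(** The first term lets the barrier dominate a noise level at most [phi]; the
    second one lets the decrease outpace the barrier when the latter decays like
    the solution of the noise-free equation. In that case [1 <= r * (2 - mu)],
    so that the exponent [1 / (q - 1) = mu / (2 - mu)] which this calls for is
    at most [2 * r]: the factor is free of [mu]. *)
Definition barrier_factor (c M : R) :=
  Num.max (64 * c / kappa c M) ((1 + decay0 / kappa c M) `^ (2 * r)).

Variables (c M mu om : R).
Hypothesis c_ge1 : 1 <= c.
Hypothesis M_ge1 : 1 <= M.
Hypothesis mu_gt1 : 1 < mu.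
Hypothesis mu_le2 : mu <= 2.
Hypothesis om_gt0 : 0 < om.

Local Notation k := (kappa c M).
Local Notation q := (2 / mu).
Local Notation s := (rate r mu).
Local Notation p := (mu * s).
Local Notation A := (barrier_factor c M * phi r mu om `^ mu).

Let c_gt0 : 0 < c. Proof. exact: lt_le_trans c_ge1. Qed.
Let M_gt0 : 0 < M. Proof. exact: lt_le_trans M_ge1. Qed.
Let mu_gt0 : 0 < mu. Proof. exact: lt_trans mu_gt1. Qed.

Lemma kappa_gt0 : 0 < k.
Proof. by rewrite invr_gt0 !mulr_gt0 ?exprn_gt0. Qed.

Lemma kappa_le1 : k <= 1.
Proof.
rewrite invf_le1 ?mulr_gt0 ?exprn_gt0 //.
have : 1 <= M ^+ 2 by rewrite exprn_ege1.
have := c_ge1; nra.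
Qed.

Lemma decay0_gt0 : 0 < decay0.
Proof. by rewrite addr_gt0 // mulr_gt0. Qed.

Lemma loj_exponent_ge1 : 1 <= q.
Proof. by rewrite ler_pdivlMr // mul1r. Qed.

Lemma factor_ge_noise : 64 * c <= barrier_factor c M.
Proof.
rewrite le_max; apply/orP; left; rewrite ler_pdivlMr ?kappa_gt0 //.
by rewrite ler_piMr ?kappa_le1 // mulr_ge0 // ltW.
Qed.

Lemma factor_ge1 : 1 <= barrier_factor c M.
Proof. by apply: le_trans factor_ge_noise; have := c_ge1; lra. Qed.

Lemma barrier_gt0 : 0 < A.
Proof.
by rewrite mulr_gt0 ?powR_gt0 ?phi_gt0 //; exact: lt_le_trans factor_ge1.
Qed.

Lemma rate_exponent_bounds : [/\ 0 <= p, 3 * p <= decay0 & p + 1 <= decay0].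
Proof.
have /andP[s0 sr] := rate_gt0_le mu_le2.
have p0 : 0 <= p by rewrite mulr_ge0 ?ltW.
have : p <= 2 * r by apply: ler_pM => //; exact: ltW.
rewrite /decay0; have := r_gt0; split; lra.
Qed.

Let barrier_powR (t a : R) : 0 < t ->
  (A * t `^ (- p)) `^ a = A `^ a * t `^ (- (p * a)).
Proof.
move=> t0; rewrite powRM ?powR_ge0 ?(ltW barrier_gt0) //.
by rewrite -powRrM mulNr.
Qed.

Let barrier_q (t : R) : 0 < t ->
  (A * t `^ (- p)) `^ q = A `^ q * t `^ (- (2 * s)).
Proof.
by move=> t0; rewrite barrier_powR //; congr (_ * _ `^ (- _)); field; rewrite gt_eqF.
Qed.

Let barrier_q1 (t : R) : 0 < t ->
  (A * t `^ (- p)) `^ (q - 1) = A `^ (q - 1) * t `^ (- (s * (2 - mu))).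
Proof.
by move=> t0; rewrite barrier_powR //; congr (_ * _ `^ (- _)); field; rewrite gt_eqF.
Qed.

Let noise_le_barrier : om <= phi r mu om -> 64 * c * om ^+ 2 <= k * A `^ q.
Proof.
move=> omphi; have q1 := loj_exponent_ge1.
have q0 : 0 <= q by exact: le_trans q1.
pose Gam := 64 * c / k.
have Gam1 : 1 <= Gam.
  rewrite ler_pdivlMr ?kappa_gt0 // mul1r (le_trans kappa_le1) //.
  by have := c_ge1; lra.
have GA : Gam * om `^ mu <= A.
  apply: ler_pM; rewrite ?powR_ge0 ?(le_trans ler01) //.
    by rewrite le_max lexx.
  apply: ge0_ler_powR => //; rewrite ?nnegrE ?(ltW mu_gt0) ?(ltW om_gt0) //.
  by apply: le_trans omphi; exact: ltW.
have : k * (Gam * om `^ mu) `^ q <= k * A `^ q.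
  rewrite ler_pM2l ?kappa_gt0 //; apply: ge0_ler_powR => //.
    by rewrite nnegrE mulr_ge0 ?powR_ge0 // (le_trans ler01).
  by rewrite nnegrE ltW // barrier_gt0.
apply: le_trans.
rewrite powRM ?powR_ge0 ?(le_trans ler01) // -powRrM.
have -> : mu * q = 2%:R by field; rewrite gt_eqF.
rewrite powR_mulrn ?(ltW om_gt0) // [leRHS]mulrA ler_pM2r ?exprn_gt0 //.
have -> : 64 * c = k * Gam by rewrite /Gam; field; rewrite gt_eqF // kappa_gt0.
by rewrite ler_pM2l ?kappa_gt0 // le1r_powR.
Qed.

Let decay_le_barrier : 1 <= phi r mu om -> 1 <= r * (2 - mu) ->
  decay0 <= k * A `^ (q - 1).
Proof.
move=> phi1 rmu; have q1 := loj_exponent_ge1.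
pose D := 1 + decay0 / k.
have D1 : 1 <= D.
  by rewrite lerDl divr_ge0 // ltW ?decay0_gt0 ?kappa_gt0.
have DA : D `^ (2 * r) <= A.
  rewrite -[leLHS]mulr1; apply: ler_pM; rewrite ?powR_ge0 //.
    by rewrite le_max lexx orbT.
  by rewrite -(powRr0 (phi r mu om)) ler_powR // ltW.
have : D <= A `^ (q - 1).
  apply: (@le_trans _ _ ((D `^ (2 * r)) `^ (q - 1))); last first.
    apply: ge0_ler_powR; rewrite ?nnegrE ?subr_ge0 ?powR_ge0 //.
    by rewrite ltW // barrier_gt0.
  rewrite -powRrM le1r_powR //.
  have -> : 2 * r * (q - 1) = q * (r * (2 - mu)) by field; rewrite gt_eqF.
  by apply: mulr_ege1.
rewrite -(ler_pM2l kappa_gt0); apply: le_trans.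
have -> : k * D = k + decay0 by rewrite /D; field; rewrite gt_eqF // kappa_gt0.
by rewrite lerDr ltW // kappa_gt0.
Qed.

(** When two sides have different exponents the comparison holds for late times
    whatever the factors are; the barrier factor settles the remaining cases of
    equal exponents. *)
Lemma barrier_eventually : exists2 T : R, 0 < T & forall t : R, T <= t ->
  [/\ 64 * c * om ^+ 2 * t `^ (- (2 * r)) <= k * (A * t `^ (- p)) `^ q,
      decay0 / t <= k * (A * t `^ (- p)) `^ (q - 1)
    & 64 * c * om ^+ 2 * t `^ (- (2 * r)) <= A * t `^ (- p)].
Proof.
have A0 := barrier_gt0; have k0 := kappa_gt0.
have kAq a : 0 < k * A `^ a by rewrite mulr_gt0 ?powR_gt0.
have /andP[s0 sr] := rate_gt0_le mu_le2.
have [T1 T10 H1] : exists2 T : R, 0 < T & forall t : R, T <= t ->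
    64 * c * om ^+ 2 * t `^ (- (2 * r)) <= k * (A * t `^ (- p)) `^ q.
  suff [T T0 HT] : exists2 T : R, 0 < T & forall t : R, T <= t ->
      64 * c * om ^+ 2 * t `^ (- (2 * r)) <= (k * A `^ q) * t `^ (- (2 * s)).
    exists T => // t Tt; have t0 : 0 < t by exact: lt_le_trans Tt.
    by rewrite barrier_q // [leRHS]mulrA HT.
  have noise_case : s = r -> om <= phi r mu om ->
      exists2 T : R, 0 < T & forall t : R, T <= t ->
      64 * c * om ^+ 2 * t `^ (- (2 * r)) <= (k * A `^ q) * t `^ (- (2 * s)).
    move=> sE omphi; exists 1 => // t _.
    by rewrite sE ler_wpM2r ?powR_ge0 // noise_le_barrier.
  have [sr'|rs] := ltP s r.
    by apply: powR_eventually_le; rewrite // ltr_pM2l.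
  apply: noise_case; first by apply/eqP; rewrite eq_le sr rs.
  move: rs; case: (rateP mu_le2) => [_ _|_ _|h /=]; rewrite ?lerDr //.
  have m0 : 0 < 2 - mu by rewrite -(pmulr_rgt0 _ r_gt0) (lt_trans ltr01).
  by rewrite leNgt -div1r ltr_pdivrMr // h.
have [T2 T20 H2] : exists2 T : R, 0 < T & forall t : R, T <= t ->
    decay0 / t <= k * (A * t `^ (- p)) `^ (q - 1).
  suff [T T0 HT] : exists2 T : R, 0 < T & forall t : R, T <= t ->
      decay0 * t `^ (- 1) <= (k * A `^ (q - 1)) * t `^ (- (s * (2 - mu))).
    exists T => // t Tt; have t0 : 0 < t by exact: lt_le_trans Tt.
    by rewrite barrier_q1 // [leRHS]mulrA -(powR_inv1 (ltW t0)) HT.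
  have decay_case : s * (2 - mu) = 1 -> 1 <= phi r mu om -> 1 <= r * (2 - mu) ->
      exists2 T : R, 0 < T & forall t : R, T <= t ->
      decay0 * t `^ (- 1) <= (k * A `^ (q - 1)) * t `^ (- (s * (2 - mu))).
    move=> sE phi1 rmu; exists 1 => // t _.
    by rewrite sE ler_wpM2r ?powR_ge0 // decay_le_barrier.
  move: decay_case (kAq (q - 1)); case: (rateP mu_le2) => [h _|h + _|h + _] /=.
  - by move=> k_gt0; exact: powR_eventually_le.
  - by apply; rewrite ?h ?lerDl // ltW.
  - apply; rewrite ?lexx ?(ltW h) // mulVf // gt_eqF //.
    by rewrite -(pmulr_rgt0 _ r_gt0) (lt_trans ltr01).
have [T3 T30 H3] : exists2 T : R, 0 < T & forall t : R, T <= t ->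
    64 * c * om ^+ 2 * t `^ (- (2 * r)) <= A * t `^ (- p).
  move: mu_le2; rewrite le_eqVlt => /predU1P[mu2|mu2].
    have [sE phiE] : s = r /\ phi r mu om = om.
      by move: (rateP mu_le2); rewrite mu2; case => //; rewrite subrr mulr0; lra.
    exists 1 => // t _; rewrite sE phiE mu2 ler_wpM2r ?powR_ge0 //.
    rewrite powR_mulrn ?(ltW om_gt0) // ler_wpM2r ?sqr_ge0 //.
    exact: factor_ge_noise.
  apply: powR_eventually_le => //.
  by apply: (@lt_le_trans _ _ (2 * s)); rewrite ?ltr_pM2r ?ler_pM2l.
exists (Num.max T1 (Num.max T2 T3)); first by rewrite lt_max T10.
move=> t; rewrite !ge_max => /and3P[t1 t2 t3].
by split; [exact: H1|exact: H2|exact: H3].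
Qed.

End Barrier.

(** * Rates for values and gradients *)

Section TrajectoryRate.
Context {R : realType} {d : nat}.
Variables (f : 'rV[R]_d -> R) (alpha : nat -> R) (theta w : nat -> 'rV[R]_d).
Variables (r om : R).
Hypothesis df : forall x, differentiable f x.
Hypothesis alpha_gt0 : forall n, 0 < alpha n.
Hypothesis alpha_cvg0 : alpha @ \oo --> 0.
Hypothesis alpha_sum : (\sum_(0 <= n <oo) (alpha n)%:E = +oo)%E.
Hypothesis rec : forall n,
  theta n.+1 = theta n - alpha n *: (grad f (theta n) + w n).
Hypothesis r_gt0 : 0 < r.
Hypothesis noise_lt : (noise_limsup alpha r w < om%:E)%E.
Local Notation gamma := (gamma alpha).
Local Notation G n := (enorm (grad f (theta n))).

Variables (c M mu fl : R).
Hypothesis c_ge1 : 1 <= c.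
Hypothesis M_ge1 : 1 <= M.
Hypothesis mu_gt1 : 1 < mu.
Hypothesis mu_le2 : mu <= 2.
Hypothesis lip : chord_lipschitz f alpha theta c.
Hypothesis value_cvg : forall e : R, 0 < e ->
  \forall n \near \oo, `|f (theta n) - fl| <= e.
Hypothesis loj : \forall n \near \oo,
  `|f (theta n) - fl| <= M * G n `^ mu.

Let u n := f (theta n) - fl.
Let om_pos : 0 < om := om_gt0 noise_lt.
Let c_gt0 : 0 < c. Proof. exact: lt_le_trans c_ge1. Qed.
Let M_gt0 : 0 < M. Proof. exact: lt_le_trans M_ge1. Qed.
Let mu_gt0 : 0 < mu. Proof. exact: lt_trans mu_gt1. Qed.

Lemma loj_gradient_lower n : `|u n| <= M * G n `^ mu ->
  `|u n| `^ (2 / mu) / M ^+ 2 <= G n ^+ 2.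
Proof.
move=> lo; have q0 : 0 <= 2 / mu by rewrite divr_ge0 // ltW.
have q2 : 2 / mu <= 2 by rewrite ler_pdivrMr // ler_peMr // ltW.
have h : `|u n| `^ (2 / mu) <= (M * G n `^ mu) `^ (2 / mu).
  apply: ge0_ler_powR => //; rewrite ?nnegrE //.
  by rewrite mulr_ge0 ?powR_ge0 // ltW.
rewrite ler_pdivrMr ?exprn_gt0 // [leRHS]mulrC; apply: (le_trans h).
rewrite powRM ?powR_ge0 ?(ltW M_gt0) // -powRrM.
have -> : mu * (2 / mu) = 2%:R by field; rewrite gt_eqF.
rewrite powR_mulrn ?enorm_ge0 // ler_wpM2r ?sqr_ge0 //.
by rewrite -powR_mulrn ?(ltW M_gt0) // ler_powR.
Qed.

Lemma value_recursion : \forall N \near \oo, forall n k, (N <= n <= k)%N ->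
  (32 * c)^-1 <= gamma k - gamma n <= 2 * (32 * c)^-1 ->
  u k <= u n - kappa c M * `|u n| `^ (2 / mu)
    + 64 * c * om ^+ 2 * gamma n `^ (- (2 * r)).
Proof.
have [N1 _ HN1] := loj.
apply: filterS2 (nbhs_infty_ge N1)
  (late_decrease df alpha_gt0 alpha_sum rec r_gt0 noise_lt c_ge1 lip).
move=> N N1N H n k /[dup] nk /andP[Nn _] win.
have := H n k nk win; have := loj_gradient_lower (HN1 n (leq_trans N1N Nn)).
rewrite -(ler_pM2l (x := (64 * c)^-1)) ?invr_gt0 ?mulr_gt0 //.
have -> : (64 * c)^-1 * (`|u n| `^ (2 / mu) / M ^+ 2) =
    kappa c M * `|u n| `^ (2 / mu).
  by rewrite /kappa; field; rewrite !gt_eqF.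
have -> : (om * gamma n `^ (- r)) ^+ 2 = om ^+ 2 * gamma n `^ (- (2 * r)).
  rewrite exprMn -[(_ `^ _) ^+ 2]powR_mulrn ?powR_ge0 // -powRrM.
  by rewrite mulNr [r * _]mulrC.
rewrite /u; lra.
Qed.

Definition rate_factor (c0 M0 : R) := 384 * c0 * barrier_factor r c0 M0.

(** The gradient inherits the rate of the values: a gradient that is large
    compared with the excess of [f] over its limit would push [f] below the
    lower barrier within one window. *)
Theorem trajectory_rate : \forall n \near \oo,
  gamma n `^ (mu * rate r mu) * `|f (theta n) - fl|
    <= rate_factor c M * phi r mu om `^ mu /\
  gamma n `^ (mu * rate r mu) * G n ^+ 2
    <= rate_factor c M * phi r mu om `^ mu.
Proof.
have [p0 p3 p1] := rate_exponent_bounds r_gt0 mu_gt1 mu_le2.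
have s0 : 0 < (32 * c)^-1 by rewrite invr_gt0 mulr_gt0.
have s1 : 2 * (32 * c)^-1 <= 1.
  by rewrite ler_pdivrMr ?mulr_gt0 // mul1r; have := c_ge1; lra.
have A0 := barrier_gt0 r c_ge1 M_ge1 mu_le2 om_pos.
have k0 := kappa_gt0 c_ge1 M_ge1.
have q1 := loj_exponent_ge1 mu_gt1 mu_le2.
have bar := barrier_eventually r_gt0 c_ge1 M_ge1 mu_gt1 mu_le2 om_pos.
have up := upper_rate alpha_gt0 alpha_cvg0 alpha_sum s0 s1 k0 q1 A0 p0 p3 p1
  value_cvg value_recursion bar.
have low := lower_rate alpha_gt0 alpha_cvg0 alpha_sum s0 k0 q1 A0 p0
  value_cvg value_recursion bar.
set p := mu * rate r mu in p0 p3 p1 up low bar *.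
set A := _ * phi r mu om `^ mu in A0 up low bar.
have -> : rate_factor c M * phi r mu om `^ mu = 384 * c * A.
  by rewrite /rate_factor /A; ring.
have [T T0 HT] := bar.
have [N _ HN] := filterI (filterI up low) (filterI
  (filterI (late_window_after alpha_gt0 alpha_cvg0 alpha_sum c_ge1)
    (late_decrease df alpha_gt0 alpha_sum rec r_gt0 noise_lt c_ge1 lip))
  (gamma_near_ge alpha_gt0 alpha_sum T)).
exists N => // n Nn; have [[un ln] [[after decr] Tn]] := HN n Nn.
have [_ _ noise_x] := HT _ Tn.
have g0 : 0 < gamma n by exact: lt_le_trans Tn.
have gp0 : 0 < gamma n `^ p by rewrite powR_gt0.
have xE : gamma n `^ p * (A * gamma n `^ (- p)) = A.
  by rewrite mulrCA powRN divff ?mulr1 ?gt_eqF.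
set x := A * gamma n `^ (- p) in un ln noise_x xE.
have x0 : 0 < x by rewrite mulr_gt0 ?powR_gt0.
split.
  apply: (@le_trans _ _ (gamma n `^ p * (4 * x))).
    by rewrite ler_pM2l // ler_norml un andbT; lra.
  rewrite mulrCA xE ler_pM2r //; have := c_ge1; lra.
apply: (@le_trans _ _ (gamma n `^ p * (384 * c * x))); last first.
  by rewrite mulrCA xE.
rewrite ler_pM2l //.
have [k nk win] := after n (leqnn n).
have [[_ lk] _] := HN k (leq_trans Nn nk).
have xk : A * gamma k `^ (- p) <= x.
  have gk : gamma n <= gamma k by exact: le_gamma.
  rewrite ler_pM2l // !powRN lef_pV2 ?posrE ?powR_gt0 //.
    by apply: ge0_ler_powR => //; rewrite ?nnegrE ltW // (lt_le_trans g0).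
  exact: lt_le_trans gk.
have nnk : (n <= n <= k)%N by rewrite leqnn.
have := decr n k nnk win.
have -> : 64 * c * (om * gamma n `^ (- r)) ^+ 2 =
    64 * c * om ^+ 2 * gamma n `^ (- (2 * r)).
  rewrite exprMn -[(_ `^ _) ^+ 2]powR_mulrn ?powR_ge0 // -powRrM.
  by rewrite mulNr [r * _]mulrC mulrA.
move=> D; have : (64 * c)^-1 * G n ^+ 2 <= 6 * x by lra.
rewrite ler_pdivrMl ?mulr_gt0 // => h; apply: (le_trans h).
by rewrite le_eqVlt; apply/orP; left; apply/eqP; ring.
Qed.

End TrajectoryRate.

Section NoiseLevelLimit.
Context {R : realType}.
Variables (r mu : R).
Hypothesis mu_le2 : mu <= 2.

Definition rate_constant (c M : R) := Num.max 1 (rate_factor r c M).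

Definition distance_constant (c M N : R) := Num.max 1 (N * rate_constant c M).

Lemma rate_constant_ge1 c M : 1 <= rate_constant c M.
Proof. by rewrite le_max lexx. Qed.

Lemma phi_le_add (x h : R) : 0 <= h -> phi r mu (x + h) <= phi r mu x + h.
Proof. by move=> h0; case: (rateP r mu_le2) => _ /=; rewrite ?addrA ?lexx ?lerDl. Qed.

(** The rate holds for every noise level above the limit superior of the noise;
    [phi] and the powers being continuous, it holds for the limit superior
    itself, including when this vanishes. *)
Lemma le_noise_level (l : \bar R) (x K e : R) : 0 <= x -> 0 < e -> 0 < K ->
  (forall om, x < om -> (l <= (K * phi r mu om `^ e)%:E)%E) ->
  (l <= (K * phi r mu x `^ e)%:E)%E.
Proof.
move=> x0 e0 K0 H; apply/lee_addgt0Pr => ep ep0; rewrite -EFinD.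
have v0 : 0 <= phi r mu x by exact: phi_ge0.
have ve0 : 0 < phi r mu x `^ e + ep / K.
  by rewrite ltr_wpDl ?powR_ge0 // divr_gt0.
pose v' := (phi r mu x `^ e + ep / K) `^ e^-1.
have v'E : v' `^ e = phi r mu x `^ e + ep / K.
  by rewrite /v' -powRrM mulVf ?gt_eqF // powRr1 // ltW.
have vv' : phi r mu x < v'.
  rewrite ltNge; apply/negP => h.
  have : v' `^ e <= phi r mu x `^ e.
    by apply: ge0_ler_powR; rewrite ?nnegrE ?powR_ge0 // ltW.
  by rewrite v'E leNgt ltrDl divr_gt0.
have h0 : 0 < v' - phi r mu x by rewrite subr_gt0.
apply: (le_trans (H (x + (v' - phi r mu x)) _)); first by rewrite ltrDl.
rewrite lee_fin; apply: (@le_trans _ _ (K * v' `^ e)).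
  rewrite ler_pM2l //; apply: ge0_ler_powR; rewrite ?nnegrE ?powR_ge0 ?(ltW e0) //.
    by rewrite phi_ge0 // addr_ge0 // ltW.
  by apply: (le_trans (phi_le_add _ (ltW h0))); rewrite addrC subrK.
by rewrite v'E mulrDr mulrCA divff ?mulr1 // gt_eqF.
Qed.

End NoiseLevelLimit.

(** * Accumulation points and limits inferior *)

Section BoundedSequences.
Context {R : realType} {d : nat}.
Implicit Types (x a : 'rV[R]_d) (A : set 'rV[R]_d) (theta : nat -> 'rV[R]_d).

Definition norm_ball (b : R) : set 'rV[R]_d := [set x | `|x| <= b].

Lemma norm_ball_compact b : compact (norm_ball b).
Proof.
apply: bounded_closed_compact.
  by exists b; split; rewrite ?num_real // => b' bb' x /= /le_trans; apply; exact: ltW.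
exact: (preimage_closed (fun _ _ => @norm_continuous _ _ _) (@closed_le _ _)).
Qed.

Lemma norm_ball_convex b x y (t : R) : 0 <= t <= 1 ->
  norm_ball b x -> norm_ball b y -> norm_ball b (x + t *: (y - x)).
Proof.
move=> /andP[t0 t1] bx yb; rewrite /norm_ball /=.
have -> : x + t *: (y - x) = (1 - t) *: x + t *: y.
  by rewrite scalerBr scalerBl scale1r addrCA addrA [t *: y + x]addrC -addrA
    [t *: y - _]addrC addrA.
rewrite (le_trans (ler_normD _ _)) // !normrZ !ger0_norm ?subr_ge0 //.
have h1 : (1 - t) * `|x| <= (1 - t) * b by rewrite ler_wpM2l ?subr_ge0.
have h2 : t * `|y| <= t * b by rewrite ler_wpM2l.
lra.
Qed.

Lemma edist_set_lt x A (b : R) : (edist_set x A < b%:E)%E ->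
  exists2 a, A a & enorm (x - a) < b.
Proof. by case/ereal_inf_lt => _ [a Aa <-]; rewrite lte_fin; exists a. Qed.

Lemma edist_set_le x a A : A a -> (edist_set x A <= (enorm (x - a))%:E)%E.
Proof. by move=> Aa; apply: ereal_inf_lbound; exists a. Qed.

Lemma closed_neighborhood_compact A (b rho : R) : A `<=` norm_ball b ->
  compact [set x | (edist_set x A <= rho%:E)%E].
Proof.
move=> Ab; apply: bounded_closed_compact.
  exists (b + rho + 1); split; rewrite ?num_real // => b' bb' x /= xA.
  have : (edist_set x A < (rho + 1)%:E)%E.
    by apply: le_lt_trans xA _; rewrite lte_fin ltrDl.
  case/edist_set_lt => a /Ab/= ab /ltW xa; apply: le_trans (ltW bb').
  rewrite -[x](subrK a) (le_trans (ler_normD _ _)) // addrC -addrA lerD //.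
  exact: le_trans (mxnorm_le_enorm _) xa.
move=> x clx /=; apply/lee_addgt0Pr => e e0; rewrite -EFinD.
have e2 : 0 < e / 2 by rewrite divr_gt0.
have [y [/= yA xy]] := clx _ (enorm_lt_near x e2).
have : (edist_set y A < (rho + e / 2)%:E)%E.
  by apply: le_lt_trans yA _; rewrite lte_fin ltrDl.
case/edist_set_lt => a Aa ya; apply: (le_trans (edist_set_le x Aa)).
rewrite lee_fin (le_trans (enorm_tri y x a)) //.
by rewrite enormBC; lra.
Qed.

(** By compactness, a bounded sequence approaches the set of its accumulation
    points: otherwise the indices at which it stays away would produce another
    accumulation point. *)
Lemma near_cluster theta (b e : R) : 0 < e -> (forall n, norm_ball b (theta n)) ->
  \forall n \near \oo,
    exists2 a, cluster (theta @ \oo) a & enorm (theta n - a) < e.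
Proof.
move=> e0 tb; apply: contrapT => far.
pose D := [set n | ~ exists2 a, cluster (theta @ \oo) a & enorm (theta n - a) < e].
have FF : ProperFilter (theta @ within D \oo).
  apply: fmap_proper_filter; apply: Build_ProperFilter => h; apply: far.
  have {}h : \forall n \near \oo, D n -> False by exact: h.
  by apply: filterS h => n h; apply: contrapT => /h.
have [p [_ clp]] : norm_ball b `&` cluster (theta @ within D \oo) !=set0.
  apply: (@norm_ball_compact b _ FF).
  by have : within D \oo (theta @^-1` norm_ball b) by apply: filterE.
have pcl : cluster (theta @ \oo) p.
  by apply: cvg_cluster clp; apply: cvg_fmap2; exact: cvg_within.
have thetaD : (theta @ within D \oo) (theta @` D).
  have : within D \oo (theta @^-1` (theta @` D)); last by [].
  by apply: filterS (withinT D _) => n Dn; exists n.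
have [_ [[n Dn <-] pn]] := clp _ _ thetaD (enorm_lt_near p e0).
by apply: Dn; exists p.
Qed.

Lemma cluster_norm_ball theta b : (forall n, norm_ball b (theta n)) ->
  cluster (theta @ \oo) `<=` norm_ball b.
Proof.
move=> tb p clp; apply/ler_addgt0Pr => e e0.
have near_tb : (theta @ \oo) (norm_ball b).
  by have : \oo (theta @^-1` norm_ball b) by apply: filterE.
have [y [yb py]] := clp _ _ near_tb (enorm_lt_near p e0).
rewrite -[p](subrK y) addrC (le_trans (ler_normD _ _)) //.
rewrite lerD //.
by rewrite (le_trans (mxnorm_le_enorm _)) // enormBC ltW.
Qed.

End BoundedSequences.

Section LimitInferior.
Context {R : realType}.
Implicit Types (u : nat -> R) (b l : R).

Lemma limn_einf_bounded u b : (forall n, `|u n| <= b) ->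
  exists l, limn_einf (fun n => (u n)%:E) = l%:E.
Proof.
move=> ub; suff : limn_einf (fun n => (u n)%:E) \is a fin_num.
  by move=> h; exists (fine (limn_einf (fun n => (u n)%:E))); rewrite fineK.
have h1 : (limn_esup (\- (fun n => (u n)%:E)) <= b%:E)%E.
  apply: limn_esup_le_near; apply: nearW => n.
  by rewrite /= lee_fin (le_trans _ (ub n)) // -normrN ler_norm.
have h2 : ((- b)%:E <= limn_esup (\- (fun n => (u n)%:E)))%E.
  rewrite leNgt; apply/negP => /limn_esup_near_lt[N _ /(_ N (leqnn N))].
  rewrite /= lte_fin ltrN2 => bu.
  by have := lt_le_trans bu (ler_norm _); rewrite ltNge ub.
rewrite /limn_einf fin_numN fin_numE; apply/andP; split.
  by apply/eqP => E; move: h2; rewrite E leeNy_eq.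
by apply/eqP => E; move: h1; rewrite E leye_eq.
Qed.

Lemma limn_einf_near_gt u l e : limn_einf (fun n => (u n)%:E) = l%:E -> 0 < e ->
  \forall n \near \oo, l - e < u n.
Proof.
move=> ul e0; have : (limn_esup (\- (fun n => (u n)%:E)) < (- (l - e))%:E)%E.
  by rewrite -lteN2 -/(limn_einf _) ul -EFinN lte_fin opprK gtrBl.
by move=> /limn_esup_near_lt; apply: filterS => n; rewrite /= lte_fin ltrN2.
Qed.

Lemma limn_einf_frequently_lt u l e N : limn_einf (fun n => (u n)%:E) = l%:E ->
  0 < e -> exists2 n, (N <= n)%N & u n < l + e.
Proof.
move=> ul e0; apply: contrapT => h.
have : (limn_esup (\- (fun n => (u n)%:E)) <= (- (l + e))%:E)%E.
  apply: limn_esup_le_near; exists N => // n Nn /=.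
  rewrite lee_fin lerN2 leNgt; apply/negP => un.
  by apply: h; exists n.
rewrite -leeN2 -/(limn_einf _) ul -EFinN lee_fin opprK.
by rewrite leNgt ltrDl e0.
Qed.

End LimitInferior.

(** * A bounded trajectory *)

Section BoundedTrajectory.
Context {R : realType} {d : nat}.
Variables (f : 'rV[R]_d -> R) (alpha : nat -> R) (theta w : nat -> 'rV[R]_d).
Variables (r : R) (C : set 'rV[R]_d -> R).
Variables (delta mu M : set 'rV[R]_d -> R -> R) (rho b fl : R).
Hypothesis df : forall x, differentiable f x.
Hypothesis alpha_gt0 : forall n, 0 < alpha n.
Hypothesis alpha_cvg0 : alpha @ \oo --> 0.
Hypothesis alpha_sum : (\sum_(0 <= n <oo) (alpha n)%:E = +oo)%E.
Hypothesis rec : forall n,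
  theta n.+1 = theta n - alpha n *: (grad f (theta n) + w n).
Hypothesis r_gt0 : 0 < r.
Hypothesis loj : lojasiewicz_constants f delta mu M.
Hypothesis gradC : gradient_constants f C.
Hypothesis rho_gt0 : 0 < rho.
Hypothesis theta_bounded : forall n, norm_ball b (theta n).
Hypothesis liminf_fl : limn_einf (fun n => (f (theta n))%:E) = fl%:E.
Local Notation gamma := (gamma alpha).
Local Notation G n := (enorm (grad f (theta n))).
Local Notation Acc := (cluster (theta @ \oo)).
Local Notation Q := [set x | (edist_set x Acc <= rho%:E)%E].

Let f_cont : continuous f.
Proof. by move=> x; apply: differentiable_continuous. Qed.

Let ball_compact : compact (norm_ball b : set 'rV[R]_d).
Proof. exact: norm_ball_compact. Qed.

Lemma lipschitz_on_chord (P : set 'rV[R]_d) (c : R) x v t :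
  lipschitz_const_on (grad f) P c -> 0 <= t -> P x -> P (x + t *: v) ->
  enorm (grad f (x + t *: v) - grad f x) <= c * (t * enorm v).
Proof.
move=> lip t0 Px Pv; have := lip _ _ Pv Px.
by rewrite [x + t *: v]addrC addrK enormZ ger0_norm.
Qed.

Lemma liminf_in_image : (f @` norm_ball b) fl.
Proof.
have : closed (f @` norm_ball b).
  apply: compact_closed; first exact: norm_hausdorff.
  apply: continuous_compact; last exact: norm_ball_compact.
  exact: continuous_subspaceT.
apply => B /nbhs_ballP[e e0 eB].
have [n1 _ low] := limn_einf_near_gt liminf_fl e0.
have [n n1n up] := limn_einf_frequently_lt n1 liminf_fl e0.
exists (f (theta n)); split; first by exists (theta n).
apply: eB; rewrite -ball_normE /= ltr_norml; apply/andP; split; first lra.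
by have := low n n1n; lra.
Qed.

(** The ball contains the whole trajectory and is convex, hence contains all
    chords. *)
Lemma chord_lipschitz_ball : chord_lipschitz f alpha theta (C (norm_ball b)).
Proof.
have [_ _ lip] := gradC ball_compact.
exists 0%N => // N _ n j t _ _ /andP[t0 t1].
apply: (lipschitz_on_chord lip t0) => //.
by apply: norm_ball_convex => //; rewrite t0.
Qed.

Section Noise.
Variable om : R.
Hypothesis noise_lt : (noise_limsup alpha r w < om%:E)%E.

(** The constants of the ball are used here because the chords of [Q] come under
    control only after the gradients are known to be small. *)
Lemma path_value_cvg (e : R) : 0 < e ->
  \forall n \near \oo, `|f (theta n) - fl| <= e.
Proof.
have [c1 gc _] := gradC ball_compact.
have [/andP[d0 _] /andP[m1 _] M1 lo] := loj ball_compact liminf_in_image.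
apply: (value_cvg df alpha_gt0 alpha_cvg0 alpha_sum rec r_gt0 noise_lt c1
  chord_lipschitz_ball _ _ _ d0 (lt_trans ltr01 m1) M1).
- by move=> n; exact: gc (theta_bounded n).
- by move=> e' e'0; exact: limn_einf_near_gt.
- by move=> e' N e'0; exact: limn_einf_frequently_lt.
- by move=> n; exact: lo (theta_bounded n).
Qed.

Lemma path_gradient_cvg0 (e : R) : 0 < e -> \forall n \near \oo, G n <= e.
Proof.
have [c1 gc _] := gradC ball_compact.
have [/andP[d0 _] /andP[m1 _] M1 lo] := loj ball_compact liminf_in_image.
apply: (gradient_cvg0 (fl := fl) df alpha_gt0 alpha_cvg0 alpha_sum rec r_gt0
  noise_lt c1 chord_lipschitz_ball _ _ _ d0 (lt_trans ltr01 m1) M1).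
- by move=> n; exact: gc (theta_bounded n).
- by move=> e' e'0; exact: limn_einf_near_gt.
- by move=> e' N e'0; exact: limn_einf_frequently_lt.
- by move=> n; exact: lo (theta_bounded n).
Qed.

Lemma window_displacement_cvg0 (e : R) : 0 < e ->
  \forall N \near \oo, forall n j, (N <= n <= j)%N -> gamma j - gamma n <= 1 ->
    enorm (theta j - theta n) <= e.
Proof.
move=> e0; have e2 : 0 < e / 2 by rewrite divr_gt0.
have [N _ HN] := filterI (path_gradient_cvg0 e2) (filterI
  (eta_near_le om alpha_gt0 alpha_sum r_gt0 e2)
  (window_noise_le alpha_gt0 alpha_sum r_gt0 noise_lt)).
exists N => // N' NN' n j /[dup] nj /andP[N'n nj'] j1.
have Nn : (N <= n)%N := leq_trans NN' N'n.
have [_ [small noise]] := HN N' NN'.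
rewrite (iterate_sub rec) //; apply: (le_trans (enormB _ _)); rewrite enormN.
have h1 := le_trans (noise n j nj j1) (small n N'n).
have : enorm (\sum_(n <= i < j) alpha i *: grad f (theta i)) <= e / 2.
  apply: (le_trans (enorm_sum _ _)).
  apply: (@le_trans _ _ (\sum_(n <= i < j) alpha i * (e / 2))).
    apply: ler_sum_nat => i /andP[ni _]; rewrite enormZ gtr0_norm // ler_pM2l //.
    by have [gi _] := HN i (leq_trans Nn ni).
  by rewrite -mulr_suml -gammaB // ler_piMl // ltW.
lra.
Qed.

Lemma accumulation_sub : Acc `<=` Q.
Proof.
move=> a Aa /=; apply: (le_trans (edist_set_le a Aa)).
by rewrite subrr enorm0 lee_fin ltW.
Qed.

Lemma neighborhood_compact : compact Q.
Proof.
exact: closed_neighborhood_compact (cluster_norm_ball theta_bounded).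
Qed.

Lemma near_neighborhood : \forall n \near \oo, Q (theta n).
Proof.
apply: filterS (near_cluster rho_gt0 theta_bounded) => n [a Aa na] /=.
by apply: (le_trans (edist_set_le _ Aa)); rewrite lee_fin ltW.
Qed.

(** By continuity every accumulation point has the limiting value. *)
Lemma liminf_in_neighborhood_image : (f @` Q) fl.
Proof.
have [N _ /(_ N (leqnn N)) [a Aa _]] := near_cluster ltr01 theta_bounded.
exists a; first exact: accumulation_sub.
apply/eqP; rewrite -subr_eq0 -normr_le0; apply/ler_addgt0Pr => e e0; rewrite add0r.
have e2 : 0 < e / 2 by rewrite divr_gt0.
have near_fl : (theta @ \oo) [set x | `|f x - fl| <= e / 2].
  exact: path_value_cvg e2.
have near_fa : nbhs a [set x | `|f a - f x| < e / 2].
  by have /cvgrPdist_lt/(_ _ e2) := f_cont (x := a).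
have [x [/= x1 x2]] := Aa _ _ near_fl near_fa.
rewrite -[f a](subrK (f x)) -addrA; apply: (le_trans (ler_normD _ _)); lra.
Qed.

(** The neighbourhood [Q] of the accumulation points need not be convex, but
    it contains every chord of a late window, because such windows are short
    and lie close to the accumulation points. *)
Lemma chord_lipschitz_neighborhood : chord_lipschitz f alpha theta (C Q).
Proof.
have [c1 _ lip] := gradC neighborhood_compact.
have r2 : 0 < rho / 2 by rewrite divr_gt0.
have [N _ HN] := filterI (near_cluster r2 theta_bounded)
  (window_displacement_cvg0 r2).
exists N => // N' NN' n j t /[dup] nj /andP[N'n _] j1 /andP[t0 t1].
have [_ disp] := HN N' NN'.
have [[a Aa na] _] := HN n (leq_trans NN' N'n).
have j1' : gamma j - gamma n <= 1.
  by apply: (le_trans j1); rewrite invf_le1 ?mulr_gt0 ?(lt_le_trans ltr01) //; lra.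
have v2 := disp n j nj j1'.
have inQ s : 0 <= s <= 1 -> Q (theta n + s *: (theta j - theta n)).
  move=> /andP[s0 s1] /=; apply: (le_trans (edist_set_le _ Aa)); rewrite lee_fin.
  rewrite addrAC; apply: (le_trans (enormD _ _)); rewrite enormZ ger0_norm //.
  have : s * enorm (theta j - theta n) <= 1 * enorm (theta j - theta n).
    by rewrite ler_wpM2r ?enorm_ge0.
  lra.
apply: (lipschitz_on_chord lip t0); last by apply: inQ; rewrite t0.
by have := inQ 0; rewrite scale0r addr0; apply; rewrite lexx ler01.
Qed.

Theorem path_rate : \forall n \near \oo,
  gamma n `^ (mu Q fl * rate r (mu Q fl)) * `|f (theta n) - fl|
    <= rate_factor r (C Q) (M Q fl) * phi r (mu Q fl) om `^ mu Q fl /\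
  gamma n `^ (mu Q fl * rate r (mu Q fl)) * G n ^+ 2
    <= rate_factor r (C Q) (M Q fl) * phi r (mu Q fl) om `^ mu Q fl.
Proof.
have [c1 _ _] := gradC neighborhood_compact.
have [/andP[d0 _] /andP[m1 m2] M1 lo] :=
  loj neighborhood_compact liminf_in_neighborhood_image.
apply: (trajectory_rate df alpha_gt0 alpha_cvg0 alpha_sum rec r_gt0 noise_lt
  c1 M1 m1 m2 chord_lipschitz_neighborhood path_value_cvg).
apply: filterS2 near_neighborhood (path_value_cvg d0) => n Qn dn.
exact: lo.
Qed.

End Noise.

Hypothesis noise_fin : (noise_limsup alpha r w < +oo)%E.
Local Notation wsup := (fine (noise_limsup alpha r w)).

Lemma wsup_ge0 : 0 <= wsup.
Proof. exact: fine_ge0 (noise_limsup_ge0 _ _ _). Qed.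

Lemma noise_lt_above om : wsup < om -> (noise_limsup alpha r w < om%:E)%E.
Proof.
by rewrite -lte_fin fineK // ge0_fin_numE // noise_limsup_ge0.
Qed.

Let exists_noise_level : {om | (noise_limsup alpha r w < om%:E)%E}.
Proof. by exists (wsup + 1); apply: noise_lt_above; rewrite ltrDl. Qed.

Let constantsQ : [/\ 1 <= C Q, 1 < mu Q fl, mu Q fl <= 2 & 1 <= M Q fl].
Proof.
have [om noise_lt] := exists_noise_level.
have [c1 _ _] := gradC neighborhood_compact.
have [_ /andP[m1 m2] M1 _] :=
  loj neighborhood_compact (liminf_in_neighborhood_image noise_lt).
by split.
Qed.

Lemma le_rate_constant y om :
  y <= rate_factor r (C Q) (M Q fl) * phi r (mu Q fl) om `^ mu Q fl ->
  y <= rate_constant r (C Q) (M Q fl) * phi r (mu Q fl) om `^ mu Q fl.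
Proof.
by move=> /le_trans; apply; rewrite ler_wpM2r ?powR_ge0 // le_max lexx orbT.
Qed.

Theorem path_limsup :
  (limn_esup (fun n => (gamma n `^ (mu Q fl * rate r (mu Q fl)) * G n ^+ 2)%:E)
    <= (rate_constant r (C Q) (M Q fl)
        * phi r (mu Q fl) wsup `^ mu Q fl)%:E)%E /\
  (limn_esup (fun n =>
      (gamma n `^ (mu Q fl * rate r (mu Q fl)) * `|f (theta n) - fl|)%:E)
    <= (rate_constant r (C Q) (M Q fl)
        * phi r (mu Q fl) wsup `^ mu Q fl)%:E)%E.
Proof.
have [c1 m1 m2 M1] := constantsQ.
have K0 : 0 < rate_constant r (C Q) (M Q fl).
  exact: lt_le_trans (rate_constant_ge1 _ _ _).
split; apply: le_noise_level => //; try exact: wsup_ge0.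
- exact: lt_trans m1.
- move=> om om_gt; apply: limn_esup_le_near.
  apply: filterS (path_rate (noise_lt_above om_gt)) => n [_ h].
  by rewrite lee_fin; exact: le_rate_constant h.
- exact: lt_trans m1.
- move=> om om_gt; apply: limn_esup_le_near.
  apply: filterS (path_rate (noise_lt_above om_gt)) => n [h _].
  by rewrite lee_fin; exact: le_rate_constant h.
Qed.

(** The error bound turns the rate of the squared gradient into its power
    [nu Q / 2], which is at most one half. *)
Theorem path_limsup_distance (nu N : set 'rV[R]_d -> R) :
  error_bound_constants f nu N ->
  (limn_esup (fun n =>
      (gamma n `^ (mu Q fl * nu Q / 2 * rate r (mu Q fl)))%:E
      * edist_set (theta n) (stationary_set f))
    <= (distance_constant r (C Q) (M Q fl) (N Q)
        * phi r (mu Q fl) wsup `^ (mu Q fl * nu Q / 2))%:E)%E.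
Proof.
move=> eb; have [/andP[nu0 nu1] N1 ebQ] := eb _ neighborhood_compact.
have [c1 m1 m2 M1] := constantsQ.
set K := rate_constant r (C Q) (M Q fl).
have K1 : 1 <= K := rate_constant_ge1 _ _ _.
have m0 : 0 < mu Q fl by exact: lt_trans m1.
have D0 : 0 < distance_constant r (C Q) (M Q fl) (N Q).
  by rewrite lt_max ltr01.
have e0 : 0 < mu Q fl * nu Q / 2 by rewrite divr_gt0 // mulr_gt0.
apply: le_noise_level => //; first exact: wsup_ge0.
move=> om om_gt; apply: limn_esup_le_near.
apply: filterS2 near_neighborhood (path_rate (noise_lt_above om_gt)).
move=> n Qn [_ /le_rate_constant].
rewrite -/K; set B := K * _ => h.
apply: (le_trans (lee_wpmul2l _ (ebQ _ Qn))); first by rewrite lee_fin powR_ge0.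
rewrite -EFinM lee_fin.
have v0 : 0 <= phi r (mu Q fl) om.
  by apply: phi_ge0 => //; exact: le_trans wsup_ge0 (ltW om_gt).
have nu2 : 0 <= nu Q / 2 by rewrite divr_ge0 // ltW.
have -> : gamma n `^ (mu Q fl * nu Q / 2 * rate r (mu Q fl)) * (N Q * G n `^ nu Q)
    = N Q * (gamma n `^ (mu Q fl * rate r (mu Q fl)) * G n ^+ 2) `^ (nu Q / 2).
  rewrite powRM ?powR_ge0 ?sqr_ge0 // -powRrM mulrCA; congr (_ * (_ `^ _ * _)).
    by field.
  rewrite -powR_mulrn ?enorm_ge0 // -powRrM; congr (_ `^ _); by field.
apply: (@le_trans _ _ (N Q * B `^ (nu Q / 2))).
  rewrite ler_wpM2l ?(le_trans ler01) //; apply: ge0_ler_powR => //.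
    by rewrite nnegrE mulr_ge0 ?powR_ge0 ?sqr_ge0.
  by rewrite nnegrE mulr_ge0 ?powR_ge0 ?(le_trans ler01).
rewrite powRM ?powR_ge0 ?(le_trans ler01) // -powRrM -!mulrA [X in X <= _]mulrA.
apply: ler_wpM2r; first exact: powR_ge0.
apply: (@le_trans _ _ (N Q * K)); last by rewrite le_max lexx orbT.
rewrite ler_wpM2l ?(le_trans ler01) // ler1_powR //.
by rewrite ler_pdivrMr // mul1r (le_trans nu1) // ler1n.
Qed.

End BoundedTrajectory.

(** * The random trajectory *)

Section RandomTrajectory.
Context {R : realType} {d : nat} {T : Type}.
Variables (f : 'rV[R]_d -> R) (theta : nat -> T -> 'rV[R]_d) (rho : T -> R).

Lemma Lambda_norm_ball omega : Lambda theta omega ->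
  exists b, forall n, norm_ball b (theta n omega).
Proof.
set S := range (fun n => (enorm (theta n omega))%:E) => supS.
have S_le n : ((enorm (theta n omega))%:E <= ereal_sup S)%E.
  by apply: ereal_sup_ubound; exists n.
have S_fin : ereal_sup S \is a fin_num.
  by rewrite ge0_fin_numE // (le_trans _ (S_le 0%N)) // lee_fin enorm_ge0.
exists (fine (ereal_sup S)) => n; apply: (le_trans (mxnorm_le_enorm _)).
by rewrite -lee_fin fineK // S_le.
Qed.

Lemma fhat_limn_einf omega : (forall x, differentiable f x) -> Lambda theta omega ->
  limn_einf (fun n => (f (theta n omega))%:E) = (fhat f theta omega)%:E.
Proof.
move=> df /Lambda_norm_ball[b tb].
have : bounded_set (f @` norm_ball b).
  apply: compact_bounded; apply: continuous_compact; last exact: norm_ball_compact.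
  by apply: continuous_subspaceT => x; apply: differentiable_continuous.
case=> m [_ /(_ (m + 1))]; rewrite ltrDl ltr01 => /(_ isT) fm.
have [l lE] : exists l, limn_einf (fun n => (f (theta n omega))%:E) = l%:E.
  by apply: (@limn_einf_bounded _ _ (m + 1)) => n; apply: fm; exists (theta n omega).
by rewrite /fhat lE.
Qed.

Lemma Qhat_Lambda omega : Lambda theta omega -> Qhat theta rho omega =
  [set x | (edist_set x (cluster ((fun n => theta n omega) @ \oo))
              <= (rho omega)%:E)%E].
Proof. by move=> L; rewrite /Qhat mem_set. Qed.

End RandomTrajectory.

Theorem theorem2p2 (R : realType) (r : R) (r_gt0 : 0 < r) :
  exists (K : R -> R -> R) (L : R -> R -> R -> R),
  forall (d : nat) (f : 'rV[R]_d -> R) (alpha : nat -> R)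
    (disp : measure_display) (T : measurableType disp) (P : probability T R)
    (theta w : nat -> T -> 'rV[R]_d)
    (C : set 'rV[R]_d -> R) (delta mu M : set 'rV[R]_d -> R -> R)
    (rho : T -> R),
  (forall x, differentiable f x) ->
  locally_lipschitz (grad f) ->
  (forall n, 0 < alpha n) ->
  random_vector (theta 0%N) ->
  (forall n, random_vector (w n)) ->
  (forall n omega, theta n.+1 omega =
     theta n omega - alpha n *: (grad f (theta n omega) + w n omega)) ->
  alpha @ \oo --> 0 ->
  (\sum_(0 <= n <oo) (alpha n)%:E = +oo)%E ->
  {ae P, forall omega, Lambda theta omega ->
     (noise_limsup alpha r (fun n => w n omega) < +oo)%E} ->
  lojasiewicz_constants f delta mu M ->
  gradient_constants f C ->
  (forall omega, 0 < rho omega) ->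
  let wsup omega := fine (noise_limsup alpha r (fun n => w n omega)) in
  let Ch := Chat theta rho C in
  let muh := muhat f theta rho mu in
  let Mh := Mhat f theta rho M in
  let ph omega := muh omega * rate r (muh omega) in
  let Kh omega := K (Ch omega) (Mh omega) in
  ((forall omega, 1 <= Kh omega) /\
   {ae P, forall omega, Lambda theta omega ->
      (limn_esup (fun n => (gamma alpha n `^ ph omega *
                            enorm (grad f (theta n omega)) ^+ 2)%:E)
         <= (Kh omega * phi r (muh omega) (wsup omega) `^ muh omega)%:E)%E /\
      (limn_esup (fun n => (gamma alpha n `^ ph omega *
                            `|f (theta n omega) - fhat f theta omega|)%:E)
         <= (Kh omega * phi r (muh omega) (wsup omega) `^ muh omega)%:E)%E})
  /\
  (forall (nu N : set 'rV[R]_d -> R),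
   error_bound_constants f nu N ->
   let nuh := nuhat f theta rho mu nu in
   let Nh := Nhat theta rho N in
   let qh omega := nuh omega * rate r (muh omega) in
   let Lh omega := L (Ch omega) (Mh omega) (Nh omega) in
   (forall omega, 1 <= Lh omega) /\
   {ae P, forall omega, Lambda theta omega ->
      (limn_esup (fun n => (gamma alpha n `^ qh omega)%:E *
                           edist_set (theta n omega) (stationary_set f))
         <= (Lh omega * phi r (muh omega) (wsup omega) `^ nuh omega)%:E)%E}).
Proof.
exists (rate_constant r), (distance_constant r).
move=> d f alpha disp T P theta w C delta mu M rho df _ alpha_gt0 _ _ rec
  alpha_cvg0 alpha_sum noise_fin loj gradC rho_gt0 /=.
split.
  split=> [omega|]; first exact: rate_constant_ge1.
  apply: filterS noise_fin => omega noise_fin Lo.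
  have [b tb] := Lambda_norm_ball Lo.
  rewrite /Chat /muhat /Mhat mem_set // (Qhat_Lambda rho Lo).
  apply: (path_limsup df alpha_gt0 alpha_cvg0 alpha_sum _ r_gt0 loj gradC
    (rho_gt0 omega) tb (fhat_limn_einf df Lo) (noise_fin Lo)) => n.
  exact: rec.
move=> nu N eb; split=> [omega|]; first by rewrite le_max lexx.
apply: filterS noise_fin => omega noise_fin Lo.
have [b tb] := Lambda_norm_ball Lo.
rewrite /Chat /muhat /Mhat /nuhat /Nhat mem_set // (Qhat_Lambda rho Lo).
apply: (path_limsup_distance df alpha_gt0 alpha_cvg0 alpha_sum _ r_gt0 loj gradC
  (rho_gt0 omega) tb (fhat_limn_einf df Lo) (noise_fin Lo) eb) => n.
exact: rec.
Qed.
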